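(* Let $T>0$ be fixed, $h_n=T/n$ and $\alpha\in(0,1)$. Assume that each of the drifts $B_1,\dots,B_4$ is globally Lipschitz and of class $C^4$ with all partial derivatives of order $0$ to $4$ of polynomial growth, and that $\sup_t\mathbb{E}[|Y_t|^{\ell}]<\infty$ for all $\ell\ge 0$ and each $Y\in\{\xi_0,\delta_0,\varepsilon_0,\zeta_0\}$. Assume $H_1$: $\mathbf{\Sigma}_0\ne\mathbf{\Sigma}(\theta)$ for every $\theta\in\Theta$. Suppose that the function $\mathbb{U}(\theta)=\mathrm{F}(\mathbf{\Sigma}_0,\mathbf{\Sigma}(\theta))$ has a unique minimizer $\bar\theta$ on $\Theta$. Then, as $h_n\to0$ (that is, $n\to\infty$), with $\mathbb{T}_n=n\mathbb{F}_n(\hat\theta_n)$, $$\mathbb{P}\bigl(\mathbb{T}_n>\chi^2_{\bar p-q}(\alpha)\bigr)\to1.$$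
   Context: Notation: $\operatorname{vech}$ is half-vectorization; $\chi^2_r(\alpha)$ is the upper $\alpha$ point of the chi-squared distribution with $r$ degrees of freedom (degrees of freedom are understood to be positive). True model and data: $p_1,p_2,k_1,k_2,r_1,\dots,r_4\ge 1$ are fixed integers with $k_1\le p_1$, $k_2\le p_2$; $p=p_1+p_2$, $\bar p=p(p+1)/2$. $W_1,\dots,W_4$ are independent standard Wiener processes of dimensions $r_1,\dots,r_4$. The latent processes $\xi_0,\delta_0,\varepsilon_0,\zeta_0$, with values in $\mathbb{R}^{k_1},\mathbb{R}^{p_1},\mathbb{R}^{p_2},\mathbb{R}^{k_2}$, solve $d\xi_{0,t}=B_1(\xi_{0,t})dt+\mathbf{S}_{1,0}dW_{1,t}$, $d\delta_{0,t}=B_2(\delta_{0,t})dt+\mathbf{S}_{2,0}dW_{2,t}$, $d\varepsilon_{0,t}=B_3(\varepsilon_{0,t})dt+\mathbf{S}_{3,0}dW_{3,t}$, $d\zeta_{0,t}=B_4(\zeta_{0,t})dt+\mathbf{S}_{4,0}dW_{4,t}$ on $[0,T]$, with deterministic initial values $c_1,\dots,c_4$ and constant matrices $\mathbf{S}_{i,0}$. Put $\mathbf{\Sigma}_{\xi\xi,0}=\mathbf{S}_{1,0}\mathbf{S}_{1,0}^\top$, $\mathbf{\Sigma}_{\delta\delta,0}=\mathbf{S}_{2,0}\mathbf{S}_{2,0}^\top$, $\mathbf{\Sigma}_{\varepsilon\varepsilon,0}=\mathbf{S}_{3,0}\mathbf{S}_{3,0}^\top$, $\mathbf{\Sigma}_{\zeta\zeta,0}=\mathbf{S}_{4,0}\mathbf{S}_{4,0}^\top$;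 $\mathbf{\Sigma}_{\delta\delta,0}$ and $\mathbf{\Sigma}_{\varepsilon\varepsilon,0}$ are positive definite. Constant matrices: $\mathbf{\Lambda}_{x_1,0}\in\mathbb{R}^{p_1\times k_1}$ of full column rank, $\mathbf{\Lambda}_{x_2,0}\in\mathbb{R}^{p_2\times k_2}$, $\mathbf{\Gamma}_0\in\mathbb{R}^{k_2\times k_1}$, $\mathbf{B}_0\in\mathbb{R}^{k_2\times k_2}$ with zero diagonal, $\mathbf{\Psi}_0=\mathbb{I}_{k_2}-\mathbf{B}_0$ non-singular. The observed process is $\mathbb{X}_t=(\mathbb{X}_{1,t}^\top,\mathbb{X}_{2,t}^\top)^\top$ with $\mathbb{X}_{1,t}=\mathbf{\Lambda}_{x_1,0}\xi_{0,t}+\delta_{0,t}$, $\mathbb{X}_{2,t}=\mathbf{\Lambda}_{x_2,0}\eta_{0,t}+\varepsilon_{0,t}$, $\eta_{0,t}=\mathbf{B}_0\eta_{0,t}+\mathbf{\Gamma}_0\xi_{0,t}+\zeta_{0,t}$. With $t_i^n=ih_n$, $T=nh_n$, $\mathbb{Q}_{\mathbb{XX}}=\frac1T\sum_{i=1}^n(\mathbb{X}_{t_i^n}-\mathbb{X}_{t_{i-1}^n})(\mathbb{X}_{t_i^n}-\mathbb{X}_{t_{i-1}^n})^\top$. Parametric model: $\Theta\subset\mathbb{R}^q$ is convex and compact. For $\theta\in\Theta$ there are matrices $\mathbf{\Lambda}_{x_1},\mathbf{\Lambda}_{x_2},\mathbf{\Gamma},\mathbf{\Psi}=\mathbb{I}_{k_2}-\mathbf{B}$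 ($\mathbf{B}$ with zero diagonal), $\mathbf{\Sigma}_{\xi\xi},\mathbf{\Sigma}_{\delta\delta},\mathbf{\Sigma}_{\varepsilon\varepsilon},\mathbf{\Sigma}_{\zeta\zeta}$ of respective sizes $p_1\times k_1$, $p_2\times k_2$, $k_2\times k_1$, $k_2\times k_2$, $k_1\times k_1$, $p_1\times p_1$, $p_2\times p_2$, $k_2\times k_2$, each entry being either a known constant or a coordinate of $\theta$ ($\theta$ collects the unknown, non-duplicated entries); $\mathbf{\Lambda}_{x_1}$ has full column rank, $\mathbf{\Psi}$ is non-singular, $\mathbf{\Sigma}_{\xi\xi},\mathbf{\Sigma}_{\zeta\zeta}$ are positive semidefinite, $\mathbf{\Sigma}_{\delta\delta},\mathbf{\Sigma}_{\varepsilon\varepsilon}$ positive definite. $\mathbf{\Sigma}(\theta)$ is the symmetric $p\times p$ matrix with blocks $\mathbf{\Sigma}^{11}=\mathbf{\Lambda}_{x_1}\mathbf{\Sigma}_{\xi\xi}\mathbf{\Lambda}_{x_1}^\top+\mathbf{\Sigma}_{\delta\delta}$, $\mathbf{\Sigma}^{12}=\mathbf{\Lambda}_{x_1}\mathbf{\Sigma}_{\xi\xi}\mathbf{\Gamma}^\top\mathbf{\Psi}^{-1\top}\mathbf{\Lambda}_{x_2}^\top$, $\mathbf{\Sigma}^{22}=\mathbf{\Lambda}_{x_2}\mathbf{\Psi}^{-1}(\mathbf{\Gamma}\mathbf{\Sigma}_{\xi\xi}\mathbf{\Gamma}^\top+\mathbf{\Sigma}_{\zeta\zeta})\mathbf{\Psi}^{-1\top}\mathbf{\Lambda}_{x_2}^\top+\mathbf{\Sigma}_{\varepsilon\varepsilon}$;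 $\mathbf{\Sigma}_0$ is the same expression evaluated at the true matrices (subscript $0$). Contrast and estimator: $\mathrm{F}(Q,\mathbf{\Sigma})=\log\det\mathbf{\Sigma}-\log\det Q+\operatorname{tr}(\mathbf{\Sigma}^{-1}Q)-p$ for $Q,\mathbf{\Sigma}$ positive definite. $\mathbb{F}_n(\theta)=\mathrm{F}(\mathbb{Q}_{\mathbb{XX}},\mathbf{\Sigma}(\theta))$ if $\mathbb{Q}_{\mathbb{XX}}$ is non-singular and $\mathbb{F}_n(\theta)=|\operatorname{vech}\mathbb{Q}_{\mathbb{XX}}-\operatorname{vech}\mathbf{\Sigma}(\theta)|^2$ otherwise. $\hat\theta_n\in\Theta$ is a minimum contrast estimator: $\mathbb{F}_n(\hat\theta_n)=\inf_{\theta\in\Theta}\mathbb{F}_n(\theta)$. *)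

(* Defs.v *)
(* MathComp / MathComp-Analysis. *)
From HB Require Import structures.
From mathcomp Require Import all_boot all_order all_algebra.
From mathcomp Require Import all_classical all_reals all_analysis.

Set Implicit Arguments.
Unset Strict Implicit.
Unset Printing Implicit Defensive.

Import Order.TTheory GRing.Theory Num.Theory.
Import numFieldNormedType.Exports.

Local Open Scope classical_set_scope.
Local Open Scope ring_scope.

Section linear_algebra.
Variable R : realType.

(* Euclidean; the library norm on matrices is the max norm. *)
Definition enorm n (v : 'cV[R]_n) : R := Num.sqrt (\sum_i v i ord0 ^+ 2).

Definition psd n (A : 'M[R]_n) : Prop :=
  A^T = A /\ forall v : 'cV[R]_n, 0 <= (v^T *m A *m v) ord0 ord0.

Definition pd n (A : 'M[R]_n) : Prop :=
  A^T = A /\ forall v : 'cV[R]_n, v != 0 -> 0 < (v^T *m A *m v) ord0 ord0.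

(* Column by column, the entries on and below the diagonal. *)
Definition vech_seq p (A : 'M[R]_p) : seq R :=
  flatten [seq [seq A i j | i <- [seq i <- enum 'I_p | (val j <= val i)%N]]
          | j <- enum 'I_p].

Definition vech_dim (p : nat) : nat := ((p * p.+1)./2)%N.

Lemma size_vech_seq p (A : 'M[R]_p) : size (vech_seq A) = vech_dim p.
Proof.
rewrite /vech_seq size_flatten /shape -map_comp sumnE big_map big_enum /=.
under eq_bigr => j _.
  rewrite size_map size_filter.
  rewrite (_ : count _ _ = (p - j)%N); last first.
    rewrite -[count _ _]/(count (leq j \o val) _) -count_map val_enum_ord.
    rewrite -[in iota 0 p](subnKC (ltnW (ltn_ord j))) iotaD count_cat add0n.
    rewrite (eq_in_count (a2 := pred0)); last first.
      by move=> x; rewrite mem_iota add0n /= => xj; rewrite leqNgt xj.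
    rewrite count_pred0 add0n (eq_in_count (a2 := predT)); last first.
      by move=> x; rewrite mem_iota => /andP[->].
    by rewrite count_predT size_iota.
  over.
rewrite /vech_dim.
suff H : ((\sum_(i < p) (p - i)).*2 = p * p.+1)%N by rewrite -H doubleK.
elim: p {A} => [|p IHp]; first by rewrite big_ord0.
rewrite big_ord_recl subn0 doubleD.
under eq_bigr do rewrite subSS.
by rewrite IHp -mul2n -mulnDl mulnC add2n.
Qed.

Definition vech p (A : 'M[R]_p) : 'cV[R]_(vech_dim p) :=
  \col_k nth 0 (vech_seq A) k.

End linear_algebra.

Section drift.
Variables (R : realType) (k : nat).
Implicit Type B : 'cV[R]_k -> 'cV[R]_k.

Definition globally_lipschitz B : Prop :=
  exists L : R, forall x y, enorm (B x - B y) <= L * enorm (x - y).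

(* Iterated partial derivative, one for each word s of coordinate indices. *)
Definition partials B (s : seq 'I_k) : 'cV[R]_k -> 'cV[R]_k :=
  foldr (fun i G x => 'D_(delta_mx i ord0) G x) B s.

Definition class_C (m : nat) B : Prop :=
  (forall s x i, (size s < m)%N ->
     derivable (partials B s) x (delta_mx i ord0)) /\
  (forall s, (size s <= m)%N -> continuous (partials B s)).

Definition polynomial_growth (G : 'cV[R]_k -> 'cV[R]_k) : Prop :=
  exists (C : R) (a : nat), forall x, enorm (G x) <= C * (1 + enorm x ^+ a).

Definition regular_drift B : Prop :=
  [/\ globally_lipschitz B, class_C 4 B &
      forall s, (size s <= 4)%N -> polynomial_growth (partials B s)].

End drift.

Section probability.
Variables (R : realType) (d : measure_display) (Omega : measurableType d).
Variable P : probability Omega R.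

Definition sigma_gen (I : Type) (D : set I) (X : I -> Omega -> R) :
    set_system Omega :=
  <<s \bigcup_(i in D)
        preimage_set_system setT (X i) (@measurable _ (measurableTypeR R)) >>.

Definition mutually_independent (I : finType) (G : I -> set_system Omega) :
    Prop :=
  forall (J : {set I}) (A : I -> set Omega),
    (forall i, i \in J -> G i (A i)) ->
    P (\big[setI/setT]_(i in J) A i) = (\prod_(i in J) P (A i))%E.

Definition brownian_motion (W : R -> Omega -> R) : Prop :=
  let incr (s t : R) := fun w => W t w - W s w in
  [/\ forall t : R, 0 <= t -> measurable_fun setT (W t),
      {ae P, forall w, W 0 w = 0},
      {ae P, forall w, {within `[0, +oo[, continuous (fun t => W t w)}},
      forall s t : R, 0 <= s -> s < t ->
        forall A : set (measurableTypeR R), measurable A ->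
        P (incr s t @^-1` A) = normal_prob 0 (Num.sqrt (t - s)) A
    & forall s t : R, 0 <= s -> s < t ->
        forall (A : set Omega) (C : set (measurableTypeR R)),
        sigma_gen `[0, s] W A -> measurable C ->
        P (A `&` incr s t @^-1` C) = (P A * P (incr s t @^-1` C))%E].

Definition wiener_process r (W : R -> Omega -> 'cV[R]_r) : Prop :=
  (forall j, brownian_motion (fun t w => W t w j ord0)) /\
  mutually_independent
    (fun j => sigma_gen `[0, +oo[ (fun t w => W t w j ord0)).

Definition process_sigma r (W : R -> Omega -> 'cV[R]_r) : set_system Omega :=
  sigma_gen [set tj : R * 'I_r | 0 <= tj.1]
    (fun tj w => W tj.1 w tj.2 ord0).

(* dY = B(Y) dt + S dW on [0, T] with Y_0 = c.  As S is constant, the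
   stochastic integral of S is S W_t and the equation is pathwise.  For
   Lipschitz B it has a unique continuous solution path, which makes Y adapted
   to the completed filtration of W without this being required here. *)
Definition sde_solution (T : R) k r (B : 'cV[R]_k -> 'cV[R]_k)
    (S : 'M[R]_(k, r)) (c : 'cV[R]_k) (W : R -> Omega -> 'cV[R]_r)
    (Y : R -> Omega -> 'cV[R]_k) : Prop :=
  [/\ forall (t : R) i, 0 <= t <= T ->
        measurable_fun setT (fun w => Y t w i ord0),
      {ae P, forall w, {within `[0, T], continuous (fun t => Y t w)}}
    & {ae P, forall w, forall t : R, 0 <= t <= T ->
        Y t w = c + \col_i (\int[lebesgue_measure]_(s in `[0, t])
                              (B (Y s w) i ord0))
                  + S *m W t w}].

Definition bounded_moments (T : R) k (Y : R -> Omega -> 'cV[R]_k) : Prop :=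
  forall l : R, 0 <= l ->
    (ereal_sup [set 'E_P[fun w => (enorm (Y t w) `^ l)%R] | t in `[0%R, T]]
      < +oo)%E.

End probability.

Section chi_squared.
Variable R : realType.

Definition Gamma_fun (s : R) : R :=
  \int[lebesgue_measure]_(x in `]0, +oo[) (x `^ (s - 1) * expR (- x)).

Definition chi2_pdf (r : nat) (x : R) : R :=
  if 0 < x then
    x `^ (r%:R / 2 - 1) * expR (- x / 2) / (2 `^ (r%:R / 2) * Gamma_fun (r%:R / 2))
  else 0.

Definition chi2_prob (r : nat) (A : set R) : \bar R :=
  (\int[lebesgue_measure]_(x in A) (chi2_pdf r x)%:E)%E.

Definition is_chi2_upper_point (r : nat) (alpha c : R) : Prop :=
  chi2_prob r `]c, +oo[ = alpha%:E.

End chi_squared.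

Section structural_equation_model.
Variables (R : realType) (p1 p2 k1 k2 : nat).

Record sem := Sem {
  Lambda_x1 : 'M[R]_(p1, k1);
  Lambda_x2 : 'M[R]_(p2, k2);
  Gamma_mx : 'M[R]_(k2, k1);
  Psi_mx : 'M[R]_k2;
  Sigma_xixi : 'M[R]_k1;
  Sigma_deltadelta : 'M[R]_p1;
  Sigma_epseps : 'M[R]_p2;
  Sigma_zetazeta : 'M[R]_k2 }.

Definition Sigma11 (m : sem) : 'M[R]_p1 :=
  Lambda_x1 m *m Sigma_xixi m *m (Lambda_x1 m)^T + Sigma_deltadelta m.

Definition Sigma12 (m : sem) : 'M[R]_(p1, p2) :=
  Lambda_x1 m *m Sigma_xixi m *m (Gamma_mx m)^T *m (invmx (Psi_mx m))^T
    *m (Lambda_x2 m)^T.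

Definition Sigma22 (m : sem) : 'M[R]_p2 :=
  Lambda_x2 m *m invmx (Psi_mx m)
    *m (Gamma_mx m *m Sigma_xixi m *m (Gamma_mx m)^T + Sigma_zetazeta m)
    *m (invmx (Psi_mx m))^T *m (Lambda_x2 m)^T + Sigma_epseps m.

Definition Sigma_sem (m : sem) : 'M[R]_(p1 + p2) :=
  block_mx (Sigma11 m) (Sigma12 m) (Sigma12 m)^T (Sigma22 m).

Definition admissible (m : sem) : Prop :=
  [/\ \rank (Lambda_x1 m) = k1,
      (forall i, (1%:M - Psi_mx m) i i = 0) /\ Psi_mx m \in unitmx,
      psd (Sigma_xixi m) /\ psd (Sigma_zetazeta m)
    & pd (Sigma_deltadelta m) /\ pd (Sigma_epseps m)].

Section parametrization.
Variables (q : nat) (Theta : set 'rV[R]_q).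

Definition known_or_coordinate a b (M : 'rV[R]_q -> 'M[R]_(a, b)) : Prop :=
  forall i j,
    (exists c : R, forall theta, Theta theta -> M theta i j = c) \/
    (exists l, forall theta, Theta theta -> M theta i j = theta ord0 l).

Definition has_coordinate (l : 'I_q) a b (M : 'rV[R]_q -> 'M[R]_(a, b)) : Prop :=
  exists i j, forall theta, Theta theta -> M theta i j = theta ord0 l.

(* The last clause says that theta consists of unknown entries only; one
   coordinate may fill several entries, as it must in symmetric matrices. *)
Definition parametric_sem (M : 'rV[R]_q -> sem) : Prop :=
  [/\ forall theta, Theta theta -> admissible (M theta),
      [/\ known_or_coordinate (fun theta => Lambda_x1 (M theta)),
          known_or_coordinate (fun theta => Lambda_x2 (M theta)),
          known_or_coordinate (fun theta => Gamma_mx (M theta))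
        & known_or_coordinate (fun theta => Psi_mx (M theta))],
      [/\ known_or_coordinate (fun theta => Sigma_xixi (M theta)),
          known_or_coordinate (fun theta => Sigma_deltadelta (M theta)),
          known_or_coordinate (fun theta => Sigma_epseps (M theta))
        & known_or_coordinate (fun theta => Sigma_zetazeta (M theta))]
    & forall l,
      has_coordinate l (fun theta => Lambda_x1 (M theta)) \/
      has_coordinate l (fun theta => Lambda_x2 (M theta)) \/
      has_coordinate l (fun theta => Gamma_mx (M theta)) \/
      has_coordinate l (fun theta => Psi_mx (M theta)) \/
      has_coordinate l (fun theta => Sigma_xixi (M theta)) \/
      has_coordinate l (fun theta => Sigma_deltadelta (M theta)) \/
      has_coordinate l (fun theta => Sigma_epseps (M theta)) \/
      has_coordinate l (fun theta => Sigma_zetazeta (M theta))].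

End parametrization.

Definition observed (Omega : Type) (L1 : 'M[R]_(p1, k1)) (L2 : 'M[R]_(p2, k2))
    (xi : R -> Omega -> 'cV[R]_k1) (delta : R -> Omega -> 'cV[R]_p1)
    (eta : R -> Omega -> 'cV[R]_k2) (eps : R -> Omega -> 'cV[R]_p2)
    (t : R) (w : Omega) : 'cV[R]_(p1 + p2) :=
  col_mx (L1 *m xi t w + delta t w) (L2 *m eta t w + eps t w).

End structural_equation_model.

Section contrast.
Variables (R : realType) (p : nat).

Definition quad_cov (T : R) (n : nat) (X : R -> 'cV[R]_p) : 'M[R]_p :=
  let h := T / n%:R in
  T^-1 *: \sum_(1 <= i < n.+1)
    (X (i%:R * h) - X (i.-1%:R * h)) *m (X (i%:R * h) - X (i.-1%:R * h))^T.

Definition F_contrast (Q S : 'M[R]_p) : R :=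
  ln (\det S) - ln (\det Q) + \tr (invmx S *m Q) - p%:R.

Definition quasi_contrast (Q S : 'M[R]_p) : R :=
  if Q \in unitmx then F_contrast Q S else enorm (vech Q - vech S) ^+ 2.

Variables (q : nat) (Theta : set 'rV[R]_q).

Definition is_minimizer (U : 'rV[R]_q -> R) (theta : 'rV[R]_q) : Prop :=
  Theta theta /\ forall theta', Theta theta' -> U theta <= U theta'.

Definition min_contrast_estimator (d : measure_display)
    (Omega : measurableType d) (Fn : nat -> Omega -> 'rV[R]_q -> R)
    (thetahat : nat -> Omega -> 'rV[R]_q) : Prop :=
  forall n, (0 < n)%N ->
    [/\ forall l, measurable_fun setT (fun w => thetahat n w ord0 l),
        forall w, Theta (thetahat n w)
      & forall w, Fn n w (thetahat n w)
                    = inf [set Fn n w theta | theta in Theta]].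

End contrast.

(* Main.v *)
From HB Require Import structures.
Require Import Defs.
From mathcomp Require Import all_boot all_order all_algebra.
From mathcomp Require Import all_classical all_reals all_analysis.
From mathcomp Require Import measurable_realfun.
From mathcomp Require Import ring lra.

(** The process X is the sum of a part with Lipschitz paths and of a linear image
    of independent Brownian motions. On a grid of step T/n the Lipschitz part
    has squared increments of sum O(1/n), almost surely, while the empirical
    covariations of the Brownian motions converge in L^2 to T or 0, by the
    second and fourth Gaussian moments and independence. Hence the realized
    covariance Q_n converges in probability to Sigma_0.

    Writing S = L L^T, the inequality ln det M <= tr M - p for the positive
    definite matrix M = L^-1 Q L^-T, strict unless M = 1, gives F(Q, S) > 0
    whenever Q <> S. Under H_1, continuity of F and compactness of Theta then
    yield c_0 > 0 with F(Q, Sigma(theta)) > c_0 for all theta in Theta and all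
    Q close to Sigma_0. With probability tending to 1, n F_n(thetahat_n) is
    thus larger than n c_0, which eventually exceeds any constant. *)

Set Implicit Arguments.
Unset Strict Implicit.
Unset Printing Implicit Defensive.

Import Order.TTheory GRing.Theory Num.Theory.
Import numFieldNormedType.Exports.

Local Open Scope classical_set_scope.
Local Open Scope ring_scope.

(** * Positive definite matrices and the contrast *)

Section positive_definite.
Variable R : realType.

(** The two parts of X call for different modes of convergence: the Lipschitz constant of a path is
    random and need not be integrable, so the smooth part is treated almost surely, while the
    Brownian part is treated in mean square. Both are turned into convergence in probability, where
    a weighted AM-GM inequality removes the cross terms. Closeness of Q to Sigma_0 also makes Q
    invertible, which selects the logarithmic branch of the contrast. Probabilities are meaningful
    on measurable events only, so the test statistic itself must be shown measurable. The contrast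
    is built from matrix entries by sums, products, inverses and logarithms; continuity and
    measurability are therefore derived together, for an abstract relation closed under these
    operations. Schur complements carry the linear algebra: the same induction yields the factor L
    and the strict logarithmic inequality. *)

Lemma pd_congr n (A G : 'M[R]_n) : pd A -> G \in unitmx -> pd (G *m A *m G^T).
Proof.
move=> [As Ap] Gu; split; first by rewrite !trmx_mul trmxK As mulmxA.
move=> v v0; have -> : v^T *m (G *m A *m G^T) *m v
    = (G^T *m v)^T *m A *m (G^T *m v) by rewrite trmx_mul trmxK !mulmxA.
apply: Ap; apply: contra_neq v0 => /(congr1 (mulmx (invmx G^T))).
by rewrite mulKmx ?unitmx_tr// mulmx0.
Qed.

Lemma psd_congr m n (A : 'M[R]_n) (G : 'M[R]_(m, n)) :
  psd A -> psd (G *m A *m G^T).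
Proof.
move=> [As Ap]; split; first by rewrite !trmx_mul trmxK As mulmxA.
move=> v; have -> : v^T *m (G *m A *m G^T) *m v
    = (G^T *m v)^T *m A *m (G^T *m v) by rewrite trmx_mul trmxK !mulmxA.
exact: Ap.
Qed.

Lemma psd_addr_pd n (A B : 'M[R]_n) : psd A -> pd B -> pd (A + B).
Proof.
move=> [As Ap] [Bs Bp]; split; first by rewrite linearD/= As Bs.
by move=> v v0; rewrite mulmxDr mulmxDl mxE ltr_wpDl// Bp.
Qed.

Lemma quad_block_diag m n (A : 'M[R]_m) (B : 'M[R]_n) (u : 'cV_m) (v : 'cV_n) :
  (col_mx u v)^T *m block_mx A 0 0 B *m col_mx u v
  = u^T *m A *m u + v^T *m B *m v.
Proof.
by rewrite tr_col_mx mul_row_block !mulmx0 addr0 add0r mul_row_col.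
Qed.

Lemma pd_block_diag m n (A : 'M[R]_m) (B : 'M[R]_n) :
  pd A -> pd B -> pd (block_mx A 0 0 B).
Proof.
move=> [As Ap] [Bs Bp]; split; first by rewrite tr_block_mx As Bs !trmx0.
move=> v; rewrite -[v]vsubmxK quad_block_diag mxE.
set u := usubmx v; set w := dsubmx v.
have A0 (x : 'cV_m) : 0 <= (x^T *m A *m x) ord0 ord0.
  by have [->|/Ap/ltW//] := eqVneq x 0; rewrite mulmx0 mxE.
have B0 (x : 'cV_n) : 0 <= (x^T *m B *m x) ord0 ord0.
  by have [->|/Bp/ltW//] := eqVneq x 0; rewrite mulmx0 mxE.
have [->|/Ap u0 _] := eqVneq u 0; last by rewrite ltr_pwDl.
have [->|/Bp w0 _] := eqVneq w 0; last by rewrite ltr_wpDl.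
by rewrite col_mx0 eqxx.
Qed.

Lemma pd_block_diag_dr m n (A : 'M[R]_m) (B : 'M[R]_n) :
  pd (block_mx A 0 0 B) -> pd B.
Proof.
move=> [ABs ABp]; split.
  by have := congr1 drsubmx ABs; rewrite tr_block_mx !block_mxKdr.
move=> v v0; have := ABp (col_mx 0 v).
rewrite quad_block_diag mulmx0 add0r; apply.
by apply: contra_neq v0 => /eqP; rewrite col_mx_eq0 => /andP[_ /eqP].
Qed.

(* The decomposition A = G diag(a, D) G^T, with G = [1, 0; b, 1]. *)
Lemma pd_schur n (A : 'M[R]_(1 + n)) : pd A ->
  exists a b D, [/\ 0 < a, pd D &
    A = block_mx a%:M (a *: b^T) (a *: b) (D + a *: (b *m b^T))].
Proof.
move=> pA; have a0 : 0 < A (lshift n ord0) (lshift n ord0).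
  have := pA.2 (col_mx 1%:M 0).
  rewrite -[in X in X -> _](submxK A) tr_col_mx mul_row_block mul_row_col.
  rewrite trmx0 mulmx0 !mul0mx !addr0 trmx1 mulmx1 mul1mx !mxE; apply.
  by rewrite col_mx_eq0 (negPf (matrix_nonzero1 _ _)).
set a := A _ _ in a0; pose b := a^-1 *: dlsubmx A.
pose D := drsubmx A - a *: (b *m b^T).
have EA : A = block_mx a%:M (a *: b^T) (a *: b) (D + a *: (b *m b^T)).
  rewrite -[LHS]submxK subrK scalerA divff ?gt_eqF// scale1r; congr block_mx.
    by rewrite [LHS]mx11_scalar !mxE.
  by rewrite linearZ/= scalerA divff ?gt_eqF// scale1r trmx_dlsub pA.1.
exists a, b, D; split=> //.
(* Inverse of the unipotent factor of the decomposition: congruence by it turns [A] into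
   [diag(a, D)], and positive definiteness passes to the lower block. *)
pose G : 'M[R]_(1 + n) := block_mx 1 0 (- b) 1%:M.
have Gu : G \in unitmx by rewrite unitmxE det_lblock !det1 mulr1 unitr1.
have := pd_congr pA Gu; rewrite EA /G tr_block_mx !mulmx_block trmx0 !trmx1.
rewrite !mul1mx !mul0mx !mulmx1 !mulmx0 !addr0 linearN/= !mul_mx_scalar.
rewrite !mul_scalar_mx !scalerN !addNr mul0mx add0r mulNmx -scalemxAr.
by rewrite addrC addrK; exact: pd_block_diag_dr.
Qed.

(** Induction on the Schur decomposition: if [D = L L^T], the factor of [A] is block lower
    triangular with diagonal blocks [sqrt a] and [L]. *)
Lemma pd_cholesky n (A : 'M[R]_n) :
  pd A -> exists2 L, L \in unitmx & A = L *m L^T.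
Proof.
elim: n A => [|n IHn]; last rewrite -[n.+1]/(1 + n)%N => A pA.
  by move=> A _; exists 1%:M; [exact: unitmx1|rewrite [LHS]flatmx0 [RHS]flatmx0].
have [a [b [D [a0 /IHn[L Lu DE] ->]]]] := pd_schur pA.
pose G : 'M[R]_(1 + n) := block_mx (Num.sqrt a)%:M 0 (Num.sqrt a *: b) L.
have Gu : G \in unitmx.
  rewrite unitmxE det_lblock det_scalar1 unitrM -unitmxE Lu andbT unitfE.
  by rewrite gt_eqF// sqrtr_gt0.
have sa : Num.sqrt a * Num.sqrt a = a by rewrite -expr2 sqr_sqrtr// ltW.
exists G => //; rewrite /G tr_block_mx mulmx_block trmx0 !mul0mx !mulmx0 !addr0.
rewrite tr_scalar_mx.
rewrite -scalar_mxM sa mul_scalar_mx linearZ/= scalerA sa mul_mx_scalar.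
by rewrite -scalemxAl -scalemxAr !scalerA sa DE addrC.
Qed.

Lemma pd_det_gt0 n (A : 'M[R]_n) : pd A -> 0 < \det A.
Proof.
move=> /pd_cholesky[L Lu ->]; rewrite det_mulmx det_tr -expr2 exprn_even_gt0//=.
by rewrite -unitfE -unitmxE.
Qed.

Lemma pd_unitmx n (A : 'M[R]_n) : pd A -> A \in unitmx.
Proof. by move=> /pd_det_gt0 d0; rewrite unitmxE unitfE gt_eqF. Qed.

Lemma ln_lt_subr1 (a : R) : 0 < a -> a != 1 -> ln a < a - 1.
Proof.
move=> a0 a1; rewrite ltrBrDl -[ltRHS](lnK a0) expR_gt1Dx//.
by rewrite ln_eq0.
Qed.

(* Induction on Schur complements, each step using ln a < a - 1. *)
Lemma ln_det_lt n (A : 'M[R]_n) :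
  pd A -> A != 1%:M -> ln (\det A) < \tr A - n%:R.
Proof.
elim: n A => [|n IHn]; first by move=> A; rewrite [A]flatmx0 [1%:M]flatmx0 eqxx.
rewrite -[n.+1]/(1 + n)%N => A pA.
have [a [b [D [a0 pD EA]]]] := pd_schur pA.
have dA : \det A = a * \det D.
  have -> : A = block_mx 1%:M 0 b 1%:M *m block_mx a%:M (a *: b^T) 0 D.
    rewrite EA mulmx_block !mul1mx !mul0mx !addr0 mul_mx_scalar.
    by rewrite -scalemxAr addrC.
  by rewrite det_mulmx det_lblock det_ublock !det1 !mul1r det_scalar1.
have tA : \tr A = a + \tr D + a * \sum_i b i ord0 ^+ 2.
  rewrite EA mxtrace_block mxtrace_scalar mulr1n linearD/= linearZ/= addrA.
  congr (_ + _ * _); apply: eq_bigr => i _.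
  by rewrite mxE big_ord1 !mxE expr2.
have b0 : 0 <= \sum_i b i ord0 ^+ 2 by apply: sumr_ge0 => i _; exact: sqr_ge0.
have lnD : ln (\det D) <= \tr D - n%:R.
  have [->|/(IHn _ pD)/ltW//] := eqVneq D 1%:M.
  by rewrite det1 ln1 mxtrace1 subrr.
have lna : ln a <= a - 1.
  have [->|/(ln_lt_subr1 a0)/ltW//] := eqVneq a 1.
  by rewrite ln1 subrr.
move=> A1; rewrite dA lnM ?posrE ?pd_det_gt0// tA -natr1.
have ab0 := mulr_ge0 (ltW a0) b0.
(* Strictness has three possible sources, [a != 1], [D != 1] and [b != 0]; all of them fail only
   when [A] is the identity. *)
have [a1|/(ln_lt_subr1 a0) ?] := eqVneq a 1; last by lra.
have [D1|/(IHn _ pD) ?] := eqVneq D 1%:M; last by lra.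
suff : 0 < a * \sum_i b i ord0 ^+ 2 by lra.
rewrite mulr_gt0// lt_neqAle b0 andbT eq_sym.
apply: contra_neq A1 => /psumr_eq0P b00; have {}b00 : b = 0.
  apply/matrixP => i j; rewrite ord1 mxE; apply/eqP.
  by rewrite -sqrf_eq0 b00// => k _; exact: sqr_ge0.
by rewrite EA a1 D1 b00 trmx0 mulmx0 !scaler0 addr0 -scalar_mx_block.
Qed.

(** The whitened matrix [M] is similar to [invmx S *m Q], so the contrast depends on [M] alone: it
    equals [\tr M - p - ln (\det M)]. *)
Lemma F_contrast_gt0 p (Q S : 'M[R]_p) :
  pd Q -> pd S -> Q <> S -> 0 < F_contrast Q S.
Proof.
move=> pQ pS QS; have [L Lu SE] := pd_cholesky pS.
have Ku : invmx L \in unitmx by rewrite unitmx_inv.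
have pM := pd_congr pQ Ku; set M := invmx L *m Q *m _ in pM.
have trM : \tr (invmx S *m Q) = \tr M.
  rewrite /M [RHS]mxtrace_mulC SE.
  have -> : invmx (L *m L^T) = (invmx L)^T *m invmx L.
    rewrite -[RHS]mulmx1 -(mulmxV (pd_unitmx pS)) mulmxA SE.
    rewrite -[(_ *m _) *m (_ *m _)]mulmxA (mulmxA (invmx L)) mulVmx//.
    by rewrite mul1mx -trmx_mul mulmxV// trmx1 mul1mx.
  by rewrite mulmxA.
have dL : \det L != 0 by rewrite -unitfE -unitmxE.
have S0 := pd_det_gt0 pS; have Q0 := pd_det_gt0 pQ.
have lnM : ln (\det M) = ln (\det Q) - ln (\det S).
  rewrite -ln_div ?posrE//; congr ln.
  rewrite /M SE !det_mulmx !det_tr det_inv; field.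
  exact: dL.
have M1 : M != 1%:M.
  apply/eqP => M1; apply: QS; rewrite SE.
  have <- : L *m M *m L^T = Q; last by rewrite M1 mulmx1.
  rewrite /M !mulmxA mulmxV// mul1mx -mulmxA -trmx_mul mulmxV// trmx1.
  by rewrite mulmx1.
have := ln_det_lt pM M1; rewrite /F_contrast trM lnM; lra.
Qed.

End positive_definite.

(** * Covariance of the reduced form of the structural equation model *)

Section sem_covariance.
Variables (R : realType) (p1 p2 k1 k2 : nat).

(** Coefficient of [xi] in the observed vector once [eta] is replaced by its solution
    [Psi^-1 (Gamma xi + zeta)]; [loading_zeta] is that of [zeta]. *)
Definition loading_xi (L1 : 'M[R]_(p1, k1)) (L2 : 'M[R]_(p2, k2))
    (G : 'M[R]_(k2, k1)) (Psi : 'M[R]_k2) : 'M[R]_(p1 + p2, k1) :=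
  col_mx L1 (L2 *m invmx Psi *m G).

Definition loading_zeta (L2 : 'M[R]_(p2, k2)) (Psi : 'M[R]_k2) :
    'M[R]_(p1 + p2, k2) :=
  col_mx 0 (L2 *m invmx Psi).

(** Each latent source contributes a congruence of its own covariance. Symmetry of [Sigma_xixi]
    matches the lower left block, which [Sigma_sem] defines as a transpose. *)
Lemma Sigma_semE (m : sem R p1 p2 k1 k2) : (Sigma_xixi m)^T = Sigma_xixi m ->
  let Ex := loading_xi (Lambda_x1 m) (Lambda_x2 m) (Gamma_mx m) (Psi_mx m) in
  let Ez := loading_zeta (Lambda_x2 m) (Psi_mx m) in
  Sigma_sem m = Ex *m Sigma_xixi m *m Ex^T + (Ez *m Sigma_zetazeta m *m Ez^T
    + block_mx (Sigma_deltadelta m) 0 0 (Sigma_epseps m)).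
Proof.
case: m => L1 L2 G Psi Sx Sd Se Sz /= Sxs.
rewrite /Sigma_sem /Sigma11 /Sigma12 /Sigma22 /=.
rewrite /loading_xi /loading_zeta !tr_col_mx !mul_col_mx !mul_mx_row.
rewrite -![col_mx (row_mx _ _) _]/(block_mx _ _ _ _) !trmx0 !mul0mx !mulmx0.
rewrite !add_block_mx !add0r !trmx_mul !trmxK Sxs.
congr block_mx; rewrite ?mulmxA ?addr0//.
by rewrite mulmxDr !mulmxDl !mulmxA addrA.
Qed.

(** Strict positivity comes from the block diagonal error covariance; the [xi] and [zeta] terms only
    add positive semidefinite matrices. *)
Lemma pd_Sigma_sem (m : sem R p1 p2 k1 k2) :
  psd (Sigma_xixi m) -> psd (Sigma_zetazeta m) ->
  pd (Sigma_deltadelta m) -> pd (Sigma_epseps m) -> pd (Sigma_sem m).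
Proof.
move=> Sx Sz Sd Se; rewrite Sigma_semE; last exact: Sx.1.
by do 2!(apply: psd_addr_pd; first exact: psd_congr); exact: pd_block_diag.
Qed.

End sem_covariance.

(** * Gaussian moments *)

Section gaussian_moments.
Variable R : realType.
Notation mu := (@lebesgue_measure R).

(** Integrability is bundled with the value, so each rule for sums, multiples and products
    transports both at once. *)
Definition has_mean d (T : measurableType d) (m : {measure set T -> \bar R})
    (f : T -> R) (e : R) : Prop :=
  m.-integrable setT (EFin \o f) /\ (\int[m]_w (f w)%:E = e%:E)%E.

Section has_mean.
Context d (T : measurableType d) (m : {measure set T -> \bar R}).

Lemma has_meanD f g a b :
  has_mean m f a -> has_mean m g b -> has_mean m (f \+ g) (a + b).
Proof.
move=> [fi fE] [gi gE]; split.
  by have := integrableD measurableT fi gi; apply: eq_integrable.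
under eq_integral do rewrite EFinD.
by rewrite integralD//= fE gE.
Qed.

Lemma has_meanZ k f a : has_mean m f a -> has_mean m (fun x => k * f x) (k * a).
Proof.
move=> [fi fE]; split.
  by have := integrableZl measurableT k fi; apply: eq_integrable.
under eq_integral do rewrite EFinM.
by rewrite integralZl//= fE.
Qed.

Lemma has_mean0 : has_mean m (cst 0) 0.
Proof. by split; [exact: integrable0|rewrite integral0]. Qed.

Lemma has_mean_sum (I : Type) (r : seq I) (f : I -> T -> R) (a : I -> R) :
  (forall i, has_mean m (f i) (a i)) ->
  has_mean m (fun x => \sum_(i <- r) f i x) (\sum_(i <- r) a i).
Proof.
move=> fa; elim: r => [|i r IHr].
  by under eq_fun do rewrite big_nil; rewrite big_nil; exact: has_mean0.
under eq_fun do rewrite big_cons; rewrite big_cons.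
exact: has_meanD.
Qed.

End has_mean.

(** With [u = x^2 / (4 s^2)] the left exponential is [e^(-2u)], the right one [e^(-u)], and
    [x^4 = 32 s^4 (u^2 / 2)]; the claim is then [u^2 / 2 <= e^u]. Doubling the variance thus absorbs
    the fourth power. *)
Lemma normal_fun_powX4_le (s x : R) : s != 0 ->
  x ^+ 4 * normal_fun 0 s x <=
    32 * s ^+ 4 * normal_fun 0 (Num.sqrt 2 * s) x.
Proof.
move=> s0; rewrite /normal_fun !subr0 exprMn sqr_sqrtr//.
have s2 : 0 < s ^+ 2 by rewrite exprn_even_gt0.
have s4 : s ^+ 4 = s ^+ 2 * s ^+ 2 by rewrite -exprD.
have x4 : x ^+ 4 = x ^+ 2 * x ^+ 2 by rewrite -exprD.
set u := x ^+ 2 / (4 * s ^+ 2).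
have -> : - x ^+ 2 / (s ^+ 2 *+ 2) = - u - u.
  by rewrite /u -mulr_natr; field; exact: s0.
have -> : - x ^+ 2 / ((2 * s ^+ 2) *+ 2) = - u.
  by rewrite /u -mulr_natr; field; exact: s0.
have u0 : 0 <= u by rewrite /u divr_ge0// ?sqr_ge0// mulr_ge0// sqr_ge0.
have xu : x ^+ 4 = 32 * s ^+ 4 * (u ^+ 2 / 2).
  by rewrite s4 x4 /u; field; exact: s0.
rewrite expRD mulrA ler_pM2r ?expR_gt0// xu -mulrA -[leRHS]mulr1 ler_pM2l.
  rewrite -ler_pdivlMr ?expR_gt0// div1r -expRN opprK.
  by apply: le_trans (expR_ge1Dxn 1 u0); rewrite lerDr.
by rewrite mulr_gt0// s4 mulr_gt0.
Qed.

(** On [[-n, n]] the fundamental theorem gives the boundary difference of [F]; dominated convergence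
    with majorant [|f|] identifies its limit with the full integral. *)
Lemma integral_derive_eq0 (f F : R -> R) : continuous f ->
  (forall x : R, derivable F x 1) -> (F^`())%classic =1 f ->
  mu.-integrable setT (EFin \o f) ->
  (fun n : nat => F n%:R - F (- n%:R)) @ \oo --> (0 : R) ->
  has_mean mu f 0.
Proof.
move=> cf dF F'f fi F0; split=> //.
pose fn n : R -> \bar R := (EFin \o f) \_ (`[- n%:R, n%:R]%classic).
have [] := @dominated_convergence _ _ R mu setT measurableT fn (EFin \o f)
  (abse \o (EFin \o f)).
- move=> n; apply/(measurable_restrictT _ _).1 => //.
  exact/measurable_funTS/measurable_int/fi.
- exact/measurable_int/fi.
- apply: aeW => x _; apply: cvg_near_cst; near=> n.
  rewrite /fn patchE mem_set//= in_itv/= -ler_norml.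
  near: n; exact: nbhs_infty_ger.
- exact: integrable_abse.
- apply: aeW => x n _; rewrite /fn patchE; case: ifPn => //= _.
  by rewrite normr0 lee_fin.
move=> _ _ fnf; apply: (cvg_unique _ fnf); first exact: ereal_hausdorff.
have : (F n%:R - F (- n%:R))%:E @[n --> \oo] --> 0%:E.
  by apply: cvg_EFin => //; exact: nearW.
apply: cvg_trans; apply: near_eq_cvg; near=> n.
have n0 : (0 < n)%N by near: n; exact: nbhs_infty_gt.
have nn : - n%:R < n%:R :> R.
  by rewrite ltrNl (lt_trans (y := 0))// ?oppr_lt0 ltr0n.
transitivity (\int[mu]_(x in `[(- n%:R)%R, n%:R]) (f x)%:E)%E; last first.
  by rewrite integral_mkcond.
rewrite (continuous_FTC2 nn (F := F))//.
- by apply: continuous_subspaceT.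
- split; first by move=> x _; exact: dF.
  + by apply: cvg_at_right_filter; apply: differentiable_continuous;
      apply/derivable1_diffP.
  + by apply: cvg_at_left_filter; apply: differentiable_continuous;
      apply/derivable1_diffP.
Unshelve. all: by end_near. Qed.

(** The Radon-Nikodym derivative and [normal_pdf] have the same integral over every measurable set,
    hence agree almost everywhere. *)
Lemma ge0_integral_normal_prob (m s : R) (f : R -> \bar R) :
  (forall x, 0 <= f x)%E -> measurable_fun setT f ->
  (\int[normal_prob m s]_x f x = \int[mu]_x (f x * (normal_pdf m s x)%:E))%E.
Proof.
move=> f0 mf; have dom := @normal_prob_dominates R m s.
rewrite -(Radon_Nikodym_SigmaFinite.change_of_variables dom)//.
have mpdf : measurable_fun setT (EFin \o normal_pdf m s).
  by apply/measurable_EFinP; exact: measurable_normal_pdf.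
have iRN := Radon_Nikodym_SigmaFinite.f_integrable dom.
apply: ae_eq_integral => //.
- by apply: emeasurable_funM => //; exact: (measurable_int _ iRN).
- exact: emeasurable_funM.
- apply: ae_eqe_mul2l; apply: integral_ae_eq => //= A _ mA.
  by rewrite -Radon_Nikodym_SigmaFinite.f_integral.
Qed.

Lemma has_mean_normal_prob (m s : R) (f : R -> R) e : measurable_fun setT f ->
  has_mean mu (fun x => f x * normal_pdf m s x) e ->
  has_mean (normal_prob m s) f e.
Proof.
move=> mf [fi fE].
have pdf0 x : (0 <= (normal_pdf m s x)%:E)%E by rewrite lee_fin normal_pdf_ge0.
have mEf : measurable_fun setT (EFin \o f) by exact/measurable_EFinP.
have fi' : (normal_prob m s).-integrable setT (EFin \o f).
  apply/integrableP; split => //.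
  rewrite ge0_integral_normal_prob//; last exact: measurableT_comp.
  case/integrableP : fi => _; apply: le_lt_trans.
  rewrite le_eqVlt; apply/orP; left; apply/eqP; apply: eq_integral => x _ /=.
  by rewrite normrM EFinM (ger0_norm (normal_pdf_ge0 _ _ _)).
split => //; rewrite -fE [LHS]integralE [RHS]integralE; congr (_ - _)%E.
- rewrite ge0_integral_normal_prob//; last exact: measurable_funepos mEf.
  apply: eq_integral => x _; rewrite !funeposE /= EFinM.
  by rewrite maxe_pMl// mul0e.
- rewrite ge0_integral_normal_prob//; last exact: measurable_funeneg mEf.
  apply: eq_integral => x _; rewrite !funenegE /= -mulNr EFinM.
  by rewrite maxe_pMl// mul0e.
Qed.

Section normal_moments.
Variable s : R.
Hypothesis s0 : s != 0.
Let g := normal_fun 0 s.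
Let s2 := Num.sqrt 2 * s.

Let cg : continuous g.
Proof.
have := @continuous_normal_pdf R 0 s s0.
rewrite normal_pdfE// => cp x.
have pk : normal_peak s != 0 by rewrite gt_eqF ?normal_peak_gt0.
have -> : g = (fun x => (normal_peak s)^-1 * (normal_peak s * normal_fun 0 s x)).
  by apply/funext => y; rewrite mulrA mulVf// mul1r.
by apply: cvgM; [exact: cvg_cst|exact: cp].
Qed.

Let integrable_g s' : s' != 0 ->
  mu.-integrable setT (EFin \o normal_fun 0 s' : R -> \bar R).
Proof.
move=> s'0; have := integrable_normal_pdf 0 s'.
move=> /(integrableZl measurableT (normal_peak s')^-1).
apply: eq_integrable => //.
move=> x _ /=; rewrite normal_pdfE// -EFinM mulrA mulVf ?mul1r//.
by rewrite gt_eqF// normal_peak_gt0.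
Qed.

Let g0 x : 0 <= g x. Proof. exact: normal_fun_ge0. Qed.

(** For [k <= 4], [|x|^k <= 1 + x^4], and the fourth power is traded for the Gaussian of doubled
    variance. *)
Let integrable_xg (k : nat) : (k <= 4)%N ->
  mu.-integrable setT (EFin \o (fun x => x ^+ k * g x)).
Proof.
move=> k4; have s20 : s2 != 0 by rewrite mulf_neq0// gt_eqF// sqrtr_gt0.
have ib : mu.-integrable setT
    (EFin \o (fun x => g x + 32 * s ^+ 4 * normal_fun 0 s2 x)).
  have := integrableD measurableT (integrable_g s0)
    (integrableZl measurableT (32 * s ^+ 4) (integrable_g s20)).
  exact: eq_integrable.
apply: le_integrable ib => //.
  apply/measurable_EFinP; apply: measurable_funM; first exact: exprn_measurable.
  exact: measurable_normal_fun.
move=> x _ /=; rewrite lee_fin normrM (ger0_norm (g0 x)).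
rewrite [leRHS]ger0_norm; last first.
  rewrite addr_ge0// mulr_ge0 ?normal_fun_ge0// mulr_ge0//.
  by rewrite exprn_even_ge0.
apply: (@le_trans _ _ (g x + x ^+ 4 * g x)); last first.
  by rewrite lerD2l; exact: normal_fun_powX4_le.
rewrite -[X in X + _]mul1r -mulrDl ler_wpM2r// normrX.
have -> : x ^+ 4 = `|x| ^+ 4 by rewrite -normrX ger0_norm// exprn_even_ge0.
have [x1|/ltW x1] := leP `|x| 1.
  by rewrite (le_trans (exprn_ile1 _ (normr_ge0 x) x1))// lerDl.
by rewrite (le_trans (ler_weXn2l x1 k4))// lerDr.
Qed.

(** Boundary terms of the integration by parts. Since [k <= 3], a power of [x] is left over in the
    bound on [x^4 g], and each end is at most [32 s^4 / n]; the factor 2 in [C] counts the two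
    ends. *)
Let xg_cvg0 (k : nat) : (k <= 3)%N ->
  (fun n : nat => n%:R ^+ k * g n%:R - (- n%:R) ^+ k * g (- n%:R))
    @ \oo --> (0 : R).
Proof.
move=> k3; pose C := 2 * (32 * s ^+ 4).
have C0 : 0 <= C by do 2 rewrite mulr_ge0//; rewrite exprn_even_ge0.
apply/cvgrPdist_le => e e0; near=> n.
have n0 : 0 < n%:R :> R by rewrite ltr0n; near: n; exact: nbhs_infty_gt.
have n1 : 1 <= n%:R :> R by rewrite ler1n -(ltr0n R).
have bnd x : `|x| = n%:R -> `|x ^+ k * g x| <= 32 * s ^+ 4 / n%:R.
  move=> xn; rewrite normrM (ger0_norm (g0 x)) normrX xn.
  rewrite ler_pdivlMr// mulrAC -exprSr.
  apply: (@le_trans _ _ (x ^+ 4 * g x)).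
    rewrite ler_wpM2r//.
    have -> : x ^+ 4 = `|x| ^+ 4 by rewrite -normrX ger0_norm// exprn_even_ge0.
    by rewrite xn ler_weXn2l.
  apply: (le_trans (normal_fun_powX4_le x s0)).
  rewrite ler_piMr//; first by rewrite mulr_ge0// exprn_even_ge0.
  rewrite /normal_fun -expR0 ler_expR mulNr oppr_le0 divr_ge0 ?sqr_ge0//.
  by rewrite mulrn_wge0// sqr_ge0.
rewrite sub0r normrN (le_trans (ler_normB _ _))//.
apply: (@le_trans _ _ (C / n%:R)).
  rewrite /C -mulrA mulr_natl mulr2n lerD ?bnd ?normrN ?ger0_norm// ltW.
rewrite ler_pdivrMr// mulrC -ler_pdivrMr//.
near: n; exact: nbhs_infty_ger.
Unshelve. all: by end_near. Qed.

Let is_derive_g (x : R) : is_derive x (1 : R) g (- (x / s ^+ 2) * g x).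
Proof.
pose c := - (s ^+ 2 *+ 2)^-1.
have -> : g = expR \o (c \*: (id ^+ 2)).
  apply/funext => y; rewrite /g /normal_fun /= subr0; congr expR.
  by rewrite fctE /GRing.scale/= /c !mulNr mulrC.
have dg := is_derive1_comp (is_derive_expR ((c \*: (id ^+ 2)) x))
  (is_deriveZ c (is_deriveX 2 (is_derive_id x (1 : R)))).
apply: (@is_derive_eq _ _ _ _ _ _ _ _ dg).
rewrite /= mulrC; congr (_ * _).
by rewrite /GRing.scale/= /c mulr1 -mulr_natr; field; rewrite s0.
Qed.

Let is_derive_xg (k : nat) (x : R) : is_derive x (1 : R) (fun x => x ^+ k * g x)
  (k%:R * (x ^+ k.-1 * g x) - (s ^+ 2)^-1 * (x ^+ k.+1 * g x)).
Proof.
have dxg := is_deriveM (is_deriveX k (is_derive_id x (1 : R))) (is_derive_g x).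
have -> : (fun x => x ^+ k * g x) = id ^+ k * g.
  by apply/funext => y; rewrite !fctE.
apply: (@is_derive_eq _ _ _ _ _ _ _ _ dxg).
rewrite /GRing.scale/= exprfctE (exprS x k); field.
by rewrite s0.
Qed.

(* Integration by parts: (x^k g)' = k x^(k-1) g - x^(k+1) g / s^2. *)
Let moment_step (k : nat) e : (k <= 3)%N ->
  has_mean mu (fun x => x ^+ k.-1 * g x) e ->
  has_mean mu (fun x => x ^+ k.+1 * g x) (s ^+ 2 * (k%:R * e)).
Proof.
move=> k3 He.
have [xi _] := He; have xi' := @integrable_xg k.+1 k3.
pose f (x : R) := k%:R * (x ^+ k.-1 * g x) - (s ^+ 2)^-1 * (x ^+ k.+1 * g x).
have fi : mu.-integrable setT (EFin \o f).
  have := integrableB measurableT (integrableZl measurableT k%:R xi)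
    (integrableZl measurableT (s ^+ 2)^-1 xi').
  by apply: eq_integrable.
have cxg j : continuous (fun x : R => x ^+ j * g x).
  by move=> x; apply: cvgM; [exact: exprn_continuous|exact: cg].
have cf : continuous f.
  by move=> x; apply: (@cvgB _ R^o); apply: cvgM;
    [exact: cvg_cst|exact: cxg|exact: cvg_cst|exact: cxg].
have F0 : has_mean mu f 0.
  apply: (@integral_derive_eq0 f (fun x : R => x ^+ k * g x)) => //.
  - by move=> x; have := is_derive_xg k x => -[].
  - by move=> x; rewrite derive1E; have := is_derive_xg k x => -[].
  - exact: xg_cvg0.
have := has_meanD (has_meanZ (s ^+ 2 * k%:R) He) (has_meanZ (- s ^+ 2) F0).
rewrite mulr0 addr0 mulrA; congr has_mean; apply/funext => x /=.
by rewrite /f; field.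
Qed.

Let normal_moment (k : nat) (e : R) :
  has_mean mu (fun x => x ^+ k * g x) ((normal_peak s)^-1 * e) ->
  has_mean (normal_prob 0 s) (fun x => x ^+ k) e.
Proof.
move=> He; apply: has_mean_normal_prob; first exact: exprn_measurable.
have pk : normal_peak s != 0 by rewrite gt_eqF ?normal_peak_gt0.
have := has_meanZ (normal_peak s) He; rewrite mulVKf//; congr has_mean.
by apply/funext => x; rewrite normal_pdfE// mulrCA.
Qed.

Let moment0 : has_mean mu (fun x => x ^+ 0 * g x) (normal_peak s)^-1.
Proof.
have -> : (fun x => x ^+ 0 * g x) =
    (fun x => (normal_peak s)^-1 * normal_pdf 0 s x).
  apply/funext => x; rewrite normal_pdfE// mul1r mulKf//.
  by rewrite gt_eqF ?normal_peak_gt0.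
rewrite -[X in has_mean _ _ X]mulr1; apply: has_meanZ; split.
  exact: integrable_normal_pdf.
exact: integral_normal_pdf.
Qed.

Lemma normal_mean : has_mean (normal_prob 0 s) (fun x => x) 0.
Proof.
apply: (@normal_moment 1); rewrite mulr0.
(* At [k = 0] the truncated predecessor [k.-1] is 0, but its term carries the factor [k = 0], so the
   first moment vanishes. *)
by have := moment_step (k := 0) isT moment0; rewrite mul0r mulr0.
Qed.

Lemma normal_moment2 : has_mean (normal_prob 0 s) (fun x => x ^+ 2) (s ^+ 2).
Proof.
apply: normal_moment.
by have := moment_step (k := 1) isT moment0; rewrite mul1r mulrC.
Qed.

Lemma normal_moment4 :
  has_mean (normal_prob 0 s) (fun x => x ^+ 4) (3 * s ^+ 4).
Proof.
apply: normal_moment.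
have := moment_step (k := 3) isT (moment_step (k := 1) isT moment0).
by congr has_mean; ring.
Qed.

End normal_moments.

End gaussian_moments.

(** * Independence and Brownian increments *)

Section independence.
Context d (Omega : measurableType d) (R : realType) (P : probability Omega R).

Definition independent2 (f g : Omega -> R) : Prop :=
  forall A B : set (measurableTypeR R), measurable A -> measurable B ->
    P (f @^-1` A `&` g @^-1` B) = (P (f @^-1` A) * P (g @^-1` B))%E.

(** Independence says that the joint law agrees with the product of the marginals on rectangles,
    hence everywhere by uniqueness of the product measure; Fubini then splits the integral. *)
Lemma has_meanM_independent2 (f g : Omega -> R) a b :
  measurable_fun setT f -> measurable_fun setT g -> independent2 f g ->
  has_mean P f a -> has_mean P g b ->
  has_mean P (fun w => f w * g w) (a * b).
Proof.
move=> mf mg fg [fi fE] [gi gE].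
pose X : {RV P >-> R} := HB.pack f (isMeasurableFun.Build _ _ _ _ _ mf).
pose Y : {RV P >-> R} := HB.pack g (isMeasurableFun.Build _ _ _ _ _ mg).
pose mu1 : probability _ R := distribution P X.
pose mu2 : probability _ R := distribution P Y.
have mfg : measurable_fun setT (fun w => (f w, g w)).
  exact: measurable_fun_pair.
pose Z : {RV P >-> (R * R)%type} := HB.pack (fun w => (f w, g w))
  (isMeasurableFun.Build _ _ _ _ _ mfg).
pose h (z : R * R) : \bar R := (z.1 * z.2)%:E.
have mh : measurable_fun setT h.
  by apply/measurable_EFinP; apply: measurable_funM;
    [exact: measurable_fst|exact: measurable_snd].
have prodE A : measurable A -> (mu1 \x mu2)%E A = distribution P Z A.
  apply: product_measure_unique => A1 A2 mA1 mA2; exact: fg.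
have xi : mu1.-integrable setT (EFin : R -> \bar R).
  by apply: integrable_pushforward => //; exact: fi.
have yi : mu2.-integrable setT (EFin : R -> \bar R).
  by apply: integrable_pushforward => //; exact: gi.
have xE : (\int[mu1]_x x%:E = a%:E)%E by rewrite integral_distribution.
have yE : (\int[mu2]_x x%:E = b%:E)%E by rewrite integral_distribution.
(* The iterated integral of [|x y|] is the product of the two absolute means, both finite. *)
have hi : (mu1 \x mu2)%E.-integrable setT h.
  apply/integrable12ltyP => //.
  have /integrableP[_ xi_lty] := xi; have /integrableP[_ yi_lty] := yi.
  have mabs : measurable_fun setT (fun x : R => `|x|%:E).
    by apply/measurable_EFinP; exact: normr_measurable.
  set c := (\int[mu2]_x `|x|%:E)%E in yi_lty.
  have c0 : (0 <= c)%E by exact: integral_ge0.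
  have cfin : c \is a fin_num by rewrite ge0_fin_numE.
  rewrite (eq_integral (fun x : R => `|x|%:E * c)%E); last first.
    move=> x _; rewrite /c -ge0_integralZl//.
    by apply: eq_integral => y _; rewrite /h /= normrM EFinM.
  rewrite -(fineK cfin) ge0_integralZr// ?lee_fin ?fine_ge0//.
  rewrite lte_mul_pinfty ?ltry ?integral_ge0// ge0_fin_numE ?integral_ge0//.
have iPh : P.-integrable setT (h \o Z).
  apply/integrableP; split; first exact: measurableT_comp.
  have /integrableP[_] := hi; congr (_ < _)%E.
  rewrite -(ge0_integral_distribution Z (f := abse \o h)).
  - by apply: eq_measure_integral => A mA _; exact: prodE.
  - exact: measurableT_comp.
  - by move=> y; exact: abse_ge0.
split; first exact: iPh.
transitivity (\int[P]_w (h \o Z) w)%E => //.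
rewrite -integral_distribution//.
rewrite -(@eq_measure_integral _ _ _ _ _ (mu1 \x mu2)%E)//; last first.
  by move=> A mA _; exact: prodE.
rewrite -integral12_prod_meas1// /fubini_F.
under eq_integral => x _.
  under eq_integral do rewrite /h /= EFinM.
  rewrite integralZl// yE.
  over.
by rewrite integralZr//= xE.
Qed.
End independence.

Section transfer.
Context d (Omega : measurableType d) (R : realType) (P : probability Omega R).

Lemma has_mean_comp_eq_law (X : Omega -> R)
    (nu : probability (measurableTypeR R) R) (g : R -> R) e :
  measurable_fun setT X -> measurable_fun setT g ->
  (forall A : set (measurableTypeR R), measurable A -> P (X @^-1` A) = nu A) ->
  has_mean nu g e -> has_mean P (g \o X) e.
Proof.
move=> mX mg Xnu [gi gE].
have mX' : measurable_fun setT (X : Omega -> measurableTypeR R) by exact: mX.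
pose Y : {RV P >-> measurableTypeR R} :=
  HB.pack X (isMeasurableFun.Build _ _ _ _ _ mX').
have mEg : measurable_fun setT (EFin \o g) by exact/measurable_EFinP.
pose muY : probability (measurableTypeR R) R := distribution P Y.
have Ynu A : measurable A -> A `<=` setT -> muY A = nu A.
  by move=> mA _; exact: Xnu.
have iP : P.-integrable setT (EFin \o (g \o X)).
  apply/integrableP; split; first exact/measurable_EFinP/measurableT_comp.
  have /integrableP[_] := gi; congr (_ < _)%E.
  rewrite -(@eq_measure_integral _ _ _ _ nu muY _ Ynu) ge0_integral_distribution//.
  exact: measurableT_comp.
split=> //; rewrite -gE -(@eq_measure_integral _ _ _ _ nu muY _ Ynu).
by rewrite (integral_distribution (X := Y)).
Qed.

Lemma independent2_comp (f g : Omega -> R) (phi psi : R -> R) :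
  measurable_fun setT phi -> measurable_fun setT psi ->
  independent2 P f g -> independent2 P (phi \o f) (psi \o g).
Proof.
move=> mphi mpsi fg A B mA mB.
by apply: (fg (phi @^-1` A) (psi @^-1` B));
  rewrite -[_ @^-1` _]setTI; [exact: mphi|exact: mpsi].
Qed.

(** [Omega] is re-equipped with the generated sigma-algebra, so that the usual closure rules of
    measurable functions apply to functions of the [X i]. *)
Lemma sigma_gen_measurable (I : Type) (D : set I) (X : I -> Omega -> R) i :
  D i -> measurable_fun setT (X i : g_sigma_algebraType (\bigcup_(i in D)
    preimage_set_system setT (X i) (@measurable _ (measurableTypeR R))) -> R).
Proof.
move=> Di _ B mB; apply: sub_sigma_algebra; exists i => //.
by exists B.
Qed.

Lemma sigma_gen_preimage (I : Type) (D : set I) (X : I -> Omega -> R)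
    (f : g_sigma_algebraType (\bigcup_(i in D)
      preimage_set_system setT (X i) (@measurable _ (measurableTypeR R))) -> R)
    (A : set (measurableTypeR R)) :
  measurable_fun setT f -> measurable A -> sigma_gen D X (f @^-1` A).
Proof. by move=> mf mA; rewrite -[_ @^-1` _]setTI; exact: mf. Qed.

Lemma sigma_gen_sub (I J : Type) (D : set I) (E : set J) (X : I -> Omega -> R)
    (Y : J -> Omega -> R) :
  (forall i, D i -> exists2 j, E j & X i = Y j) ->
  sigma_gen D X `<=` sigma_gen E Y.
Proof.
move=> DE; apply: smallest_sub; first exact: smallest_sigma_algebra.
move=> A [i /DE[j Ej XY] XA]; apply: sub_sigma_algebra.
by exists j => //; rewrite -XY.
Qed.

Lemma has_mean_cst (a : R) : has_mean P (cst a) a.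
Proof.
split; first exact: finite_measure_integrable_cst.
transitivity (\int[P]_w (cst a%:E) w)%E => //.
by rewrite integral_cst//= probability_setT mule1.
Qed.

(** Orthogonality: after expanding the square only the diagonal terms have non-zero mean. *)
Lemma has_mean_sqr_sum (I : eqType) (r : seq I) (f : I -> Omega -> R) (v : R) :
  uniq r ->
  (forall i j, i \in r -> j \in r ->
     has_mean P (fun w => f i w * f j w) (if i == j then v else 0)) ->
  has_mean P (fun w => (\sum_(i <- r) f i w) ^+ 2) (v *+ size r).
Proof.
move=> ur fv.
(* [has_mean_sum] asks for a mean at every index, so pairs outside [r] are replaced by 0. *)
have H : has_mean P (fun w => \sum_(i <- r) \sum_(j <- r)
      (if (i \in r) && (j \in r) then f i w * f j w else 0))
    (\sum_(i <- r) \sum_(j <- r) if (i \in r) && (j \in r) then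
       (if i == j then v else 0) else 0).
  apply: has_mean_sum => i; apply: has_mean_sum => j.
  case: ifPn => [/andP[ir jr]|_]; last exact: has_mean0.
  exact: fv.
move: H; congr has_mean.
  apply/funext => w; rewrite expr2 big_distrlr/=.
  rewrite big_seq [RHS]big_seq; apply: eq_bigr => i ir.
  by rewrite big_seq [RHS]big_seq; apply: eq_bigr => j jr; rewrite ir jr.
have -> : v *+ size r = \sum_(i <- r) v.
  by rewrite big_const_seq count_predT iter_addr_0.
rewrite big_seq [RHS]big_seq; apply: eq_bigr => i ir.
rewrite (bigD1_seq i)//= ir eqxx/= big1_seq ?addr0// => j /andP[ji jr].
by rewrite jr eq_sym (negPf ji).
Qed.

End transfer.

Section brownian_increments.
Context d (Omega : measurableType d) (R : realType) (P : probability Omega R).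
Implicit Type W : R -> Omega -> R.

Definition increment W (s t : R) (w : Omega) : R := W t w - W s w.

Lemma measurable_increment W s t : brownian_motion P W -> 0 <= s -> 0 <= t ->
  measurable_fun setT (increment W s t).
Proof. by move=> [mW _ _ _ _] s0 t0; apply: measurable_funB; exact: mW. Qed.

Section moments.
Variables (W : R -> Omega -> R) (s t : R).
Hypotheses (hW : brownian_motion P W) (s0 : 0 <= s) (st : s < t).

Let t0 : 0 <= t. Proof. exact: le_trans (ltW st). Qed.

Let sqrt_neq0 : Num.sqrt (t - s) != 0.
Proof. by rewrite gt_eqF// sqrtr_gt0 subr_gt0. Qed.

Let sqr_sqrt : Num.sqrt (t - s) ^+ 2 = t - s.
Proof. by rewrite sqr_sqrtr// subr_ge0 ltW. Qed.

Let law (g : R -> R) e : measurable_fun setT g ->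
  has_mean (normal_prob 0 (Num.sqrt (t - s))) g e ->
  has_mean P (g \o increment W s t) e.
Proof.
move=> mg; apply: has_mean_comp_eq_law => //; first exact: measurable_increment.
by case: hW => _ _ _ + _; exact.
Qed.

Lemma mean_increment : has_mean P (increment W s t) 0.
Proof. exact/(law (g := id))/normal_mean. Qed.

Lemma mean_increment2 : has_mean P (fun w => increment W s t w ^+ 2) (t - s).
Proof.
by rewrite -sqr_sqrt; apply/(law (exprn_measurable 2))/normal_moment2.
Qed.

Lemma mean_increment4 :
  has_mean P (fun w => increment W s t w ^+ 4) (3 * (t - s) ^+ 2).
Proof.
rewrite -[X in 3 * X ^+ 2]sqr_sqrt -exprM.
by apply/(law (exprn_measurable 4))/normal_moment4.
Qed.

(** An increment between times of [[0, s]] is measurable for the past at [s], of which the next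
    increment is independent. *)
Lemma increment_independent a b : 0 <= a -> a <= s -> 0 <= b -> b <= s ->
  independent2 P (increment W a b) (increment W s t).
Proof.
move=> a0 as_ b0 bs A B mA mB; case: hW => _ _ _ _; apply => //.
apply: sigma_gen_preimage => //; apply: measurable_funB;
  by apply: sigma_gen_measurable; rewrite /= in_itv/=; apply/andP.
Qed.

End moments.

Section grid.
Variables (T : R) (n : nat).
Hypotheses (T0 : 0 < T) (n0 : (0 < n)%N).

(** Cells are numbered from 1; at [i = 0] the predecessor truncates and the increment is zero,
    whence the conditions [0 < i] below. *)
Definition grid_incr W (i : nat) : Omega -> R :=
  increment W (i.-1%:R * (T / n%:R)) (i%:R * (T / n%:R)).

Let h := T / n%:R.
Let h0 : 0 < h. Proof. by rewrite divr_gt0// ltr0n. Qed.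

Let tge0 (i : nat) : 0 <= i%:R * h. Proof. by rewrite mulr_ge0// ltW. Qed.

Let tlt (i : nat) : (0 < i)%N -> i.-1%:R * h < i%:R * h.
Proof. by move=> i0; rewrite ltr_pM2r// ltr_nat prednK. Qed.

Let tle (i j : nat) : (i <= j)%N -> i%:R * h <= j%:R * h.
Proof. by move=> ij; rewrite ler_pM2r// ler_nat. Qed.

Let tB (i : nat) : (0 < i)%N -> i%:R * h - i.-1%:R * h = h.
Proof. by case: i => // i _; rewrite -mulrBl -natrB//= subSnn mul1r. Qed.

Let size_grid : size (index_iota 1 n.+1) = n.
Proof. by rewrite size_iota subSS subn0. Qed.

Let sum_h : h *+ n = T.
Proof. by rewrite -mulr_natr /h divfK// pnatr_eq0 -lt0n. Qed.

Lemma measurable_grid_incr W i :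
  brownian_motion P W -> measurable_fun setT (grid_incr W i).
Proof. by move=> hW; apply: measurable_increment => //; exact: tge0. Qed.

Lemma grid_incr_independent W i j : brownian_motion P W -> (0 < i < j)%N ->
  independent2 P (grid_incr W i) (grid_incr W j).
Proof.
move=> hW /andP[i0 ij]; have j0 : (0 < j)%N by exact: leq_trans ij.
have ij' : (i <= j.-1)%N by rewrite -ltnS prednK.
apply: increment_independent => //; rewrite ?tge0 ?tlt ?tle//.
by rewrite (leq_trans (leq_pred _)).
Qed.

(** The centred squares are orthogonal by independence, and each has second moment
    [3 h^2 - 2 h * h + h^2 = 2 h^2]. The total is [2 T^2 / n]. *)
Lemma mean_quad_variation W : brownian_motion P W ->
  has_mean P (fun w => (\sum_(1 <= i < n.+1) grid_incr W i w ^+ 2 - T) ^+ 2)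
    (2 * h ^+ 2 *+ n).
Proof.
move=> hW; pose f i w := grid_incr W i w ^+ 2 - h.
have m2 i : (0 < i)%N -> has_mean P (fun w => grid_incr W i w ^+ 2) h.
  by move=> i0; rewrite -(tB i0); apply: mean_increment2; rewrite ?tge0 ?tlt.
have m4 i : (0 < i)%N -> has_mean P (fun w => grid_incr W i w ^+ 4) (3 * h ^+ 2).
  by move=> i0; rewrite -(tB i0); apply: mean_increment4; rewrite ?tge0 ?tlt.
have mf i : (0 < i)%N -> has_mean P (f i) 0.
  move=> i0; rewrite -[X in has_mean _ _ X](subrr h).
  exact: has_meanD (m2 i i0) (has_mean_cst P (- h)).
have ff i j : (0 < i < j)%N -> has_mean P (fun w => f i w * f j w) 0.
  move=> ij; have i0 : (0 < i)%N by case/andP: ij.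
  have j0 : (0 < j)%N by case/andP: ij => _ /(leq_ltn_trans (leq0n i)).
  rewrite -[X in has_mean _ _ X](mulr0 0).
  have mphi : measurable_fun setT (fun x : R => x ^+ 2 - h).
    by apply: measurable_funB => //; exact: exprn_measurable.
  apply: has_meanM_independent2; [| | |exact: mf|exact: mf].
  - exact: (measurableT_comp mphi (measurable_grid_incr _ hW)).
  - exact: (measurableT_comp mphi (measurable_grid_incr _ hW)).
  - exact: (independent2_comp mphi mphi (grid_incr_independent hW ij)).
have f2 i : (0 < i)%N -> has_mean P (fun w => f i w * f i w) (2 * h ^+ 2).
  move=> i0; have := has_meanD (has_meanD (m4 i i0)
    (has_meanZ (- (2 * h)) (m2 i i0))) (has_mean_cst P (h ^+ 2)).
  by congr has_mean; [apply/funext => w; rewrite /f /=|]; ring.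
have := has_mean_sqr_sum (P := P) (v := 2 * h ^+ 2) (f := f) (iota_uniq 1 n).
rewrite size_iota; move=> /(_ _)/wrap[].
  move=> i j; rewrite !mem_iota => /andP[i0 _] /andP[j0 _].
  have [ij|ji|<-] := ltngtP i j.
  - by apply: ff; rewrite i0.
  - under eq_fun do rewrite mulrC.
    by apply: ff; rewrite j0.
  - exact: f2.
congr has_mean; apply/funext => w; congr (_ ^+ 2).
rewrite /f sumrB big_const_seq count_predT iter_addr_0 size_iota sum_h.
by rewrite /index_iota subSS subn0.
Qed.

(** The four factors of [f i * f j] are regrouped by process. Independence of [W] and [W'] splits
    the mean into two factors, each [h] on the diagonal and 0 off it. *)
Lemma mean_quad_covariation W W' :
  brownian_motion P W -> brownian_motion P W' ->
  (forall A B, sigma_gen `[0, +oo[ W A -> sigma_gen `[0, +oo[ W' B ->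
     P (A `&` B) = (P A * P B)%E) ->
  has_mean P
    (fun w => (\sum_(1 <= i < n.+1) grid_incr W i w * grid_incr W' i w) ^+ 2)
    (h ^+ 2 *+ n).
Proof.
move=> hW hW' WW'; pose f i w := grid_incr W i w * grid_incr W' i w.
have inc V i : (0 < i)%N -> brownian_motion P V ->
    has_mean P (grid_incr V i) 0 /\ has_mean P (fun w => grid_incr V i w ^+ 2) h.
  move=> i0 hV; split; first by apply: mean_increment; rewrite ?tge0 ?tlt.
  by rewrite -(tB i0); apply: mean_increment2; rewrite ?tge0 ?tlt.
have indep i j : independent2 P (fun w => grid_incr W i w * grid_incr W j w)
    (fun w => grid_incr W' i w * grid_incr W' j w).
  move=> A B mA mB; apply: WW'; apply: sigma_gen_preimage => //;
  by apply: measurable_funM; apply: measurable_funB; apply: sigma_gen_measurable;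
    rewrite /= in_itv/= andbT tge0.
have mM V i j : brownian_motion P V ->
    measurable_fun setT (fun w => grid_incr V i w * grid_incr V j w).
  by move=> hV; apply: measurable_funM; exact: measurable_grid_incr.
have two V i j : (0 < i)%N -> (0 < j)%N -> brownian_motion P V ->
    has_mean P (fun w => grid_incr V i w * grid_incr V j w)
      (if i == j then h else 0).
  move=> i0 j0 hV; have [V0i V2i] := inc V i i0 hV; have [V0j _] := inc V j j0 hV.
  have [ij|ji|<-] := ltngtP i j.
  - rewrite -[X in has_mean _ _ X](mulr0 0).
    apply: has_meanM_independent2 => //; try exact: measurable_grid_incr.
    by apply: grid_incr_independent; rewrite ?i0.
  - rewrite -[X in has_mean _ _ X](mulr0 0).
    under eq_fun do rewrite mulrC.
    apply: has_meanM_independent2 => //; try exact: measurable_grid_incr.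
    by apply: grid_incr_independent; rewrite ?j0.
  - by [].
have := has_mean_sqr_sum (P := P) (v := h ^+ 2) (f := f) (iota_uniq 1 n).
rewrite size_iota; move=> /(_ _)/wrap[].
  move=> i j; rewrite !mem_iota => /andP[i0 _] /andP[j0 _].
  have := has_meanM_independent2 (mM _ _ _ hW) (mM _ _ _ hW') (indep i j)
    (two W i j i0 j0 hW) (two W' i j i0 j0 hW').
  congr has_mean; first by apply/funext => w; rewrite /f; ring.
  by case: ifP => _; rewrite ?mulr0.
by rewrite /index_iota subSS subn0.
Qed.

End grid.
End brownian_increments.

(** * Convergence in probability *)

Section convergence_in_probability.
Context d (Omega : measurableType d) (R : realType) (P : probability Omega R).
Implicit Types (Z : nat -> Omega -> R) (z : R).

(* Stated with measurable events on which the variables are close, because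
   [P] is unspecified on non-measurable sets. *)
Definition cvg_in_prob Z z : Prop :=
  forall e eta : R, 0 < e -> 0 < eta -> \forall n \near \oo,
    exists E, [/\ measurable E, (P (~` E) <= eta%:E)%E &
                  forall w, E w -> `|Z n w - z| <= e].

Lemma probability_setCI_le (E F : set Omega) (a b : R) :
  measurable E -> measurable F -> (P (~` E) <= a%:E)%E -> (P (~` F) <= b%:E)%E ->
  (P (~` (E `&` F)) <= (a + b)%:E)%E.
Proof.
move=> mE mF Ea Fb; rewrite setCI EFinD.
apply: le_trans (leeD Ea Fb).
by apply: measureU2; exact: measurableC.
Qed.

(** Reduces a limit in probability to a pathwise implication between error bounds, used on the
    intersection of two events each missing at most [eta / 2]. Taking [Z1 = Z2] covers one
    variable. *)
Lemma cvg_in_prob_bound2 Z1 Z2 Z z1 z2 z :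
  (forall e, 0 < e -> exists2 e', 0 < e' &
    \forall n \near \oo, forall w, `|Z1 n w - z1| <= e' -> `|Z2 n w - z2| <= e' ->
       `|Z n w - z| <= e) ->
  cvg_in_prob Z1 z1 -> cvg_in_prob Z2 z2 -> cvg_in_prob Z z.
Proof.
move=> HZ H1 H2 e eta e0 eta0; have [e' e'0 He'] := HZ e e0.
have eta20 : 0 < eta / 2 by rewrite divr_gt0.
near=> n.
have [E1 [mE1 PE1 HE1]] : exists E, [/\ measurable E,
    (P (~` E) <= (eta / 2)%:E)%E & forall w, E w -> `|Z1 n w - z1| <= e']
  by near: n; exact: H1.
have [E2 [mE2 PE2 HE2]] : exists E, [/\ measurable E,
    (P (~` E) <= (eta / 2)%:E)%E & forall w, E w -> `|Z2 n w - z2| <= e']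
  by near: n; exact: H2.
exists (E1 `&` E2); split; first exact: measurableI.
  by rewrite [eta]splitr; exact: probability_setCI_le.
move=> w [E1w E2w]; have : `|Z2 n w - z2| <= e' by exact: HE2.
have : `|Z1 n w - z1| <= e' by exact: HE1.
by move: w {E1w E2w}; near: n.
Unshelve. all: by end_near. Qed.

Lemma cvg_in_probD Z1 Z2 z1 z2 : cvg_in_prob Z1 z1 -> cvg_in_prob Z2 z2 ->
  cvg_in_prob (fun n w => Z1 n w + Z2 n w) (z1 + z2).
Proof.
apply: cvg_in_prob_bound2 => e e0; exists (e / 2); first by rewrite divr_gt0.
apply: nearW => n w H1 H2; rewrite opprD addrACA (le_trans (ler_normD _ _))//.
by rewrite [e]splitr lerD.
Qed.

Lemma cvg_in_probZ k Z z : cvg_in_prob Z z ->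
  cvg_in_prob (fun n w => k * Z n w) (k * z).
Proof.
move=> H; apply: (cvg_in_prob_bound2 _ H H) => e e0.
have k0 : 0 < `|k| + 1 by rewrite ltr_wpDl.
exists (e / (`|k| + 1)); first by rewrite divr_gt0.
apply: nearW => n w Hw _; rewrite -mulrBr normrM.
rewrite ler_pdivlMr// mulrC in Hw; apply: le_trans Hw.
by rewrite ler_wpM2r// lerDl.
Qed.

Lemma cvg_in_prob_cst z : cvg_in_prob (fun _ _ => z) z.
Proof.
move=> e eta e0 eta0; apply: nearW => n; exists setT; split=> //.
  by rewrite setCT measure0 lee_fin ltW.
by move=> w _; rewrite subrr normr0 ltW.
Qed.

Lemma cvg_in_prob_sum (I : Type) (r : seq I) (Z : I -> nat -> Omega -> R)
    (z : I -> R) :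
  (forall i, cvg_in_prob (Z i) (z i)) ->
  cvg_in_prob (fun n w => \sum_(i <- r) Z i n w) (\sum_(i <- r) z i).
Proof.
move=> H; elim: r => [|i r IHr].
  rewrite big_nil; under eq_fun do under eq_fun do rewrite big_nil.
  exact: cvg_in_prob_cst.
rewrite big_cons; under eq_fun do under eq_fun do rewrite big_cons.
exact: cvg_in_probD.
Qed.

(** Egorov's theorem: convergence is uniform off a set of measure below [eta], and the complement of
    that set is the required event for all large [n]. *)
Lemma ae_cvg_in_prob Z z : (forall n, measurable_fun setT (Z n)) ->
  {ae P, forall w, Z ^~ w @ \oo --> z} -> cvg_in_prob Z z.
Proof.
move=> mZ aeZ e eta e0 eta0.
have [||B [mB PB HB]] := @ae_pointwise_almost_uniform _ _ _ P Z (cst z) setT eta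
  mZ (measurable_cst _) measurableT _ _ eta0.
- by rewrite -ge0_fin_numE// fin_num_measure.
- by apply: filterS aeZ => w + _.
have /HB : nbhs (cst z : {uniform` setT `\` B -> R})
    [set f | forall w, (setT `\` B) w -> `|f w - z| <= e].
  apply/uniform_nbhs; exists [set xy | ball xy.1 e xy.2]; split.
    exact: (entourage_ball _ (PosNum e0)).
  by move=> f Hf w /Hf; rewrite /ball/= distrC => /ltW.
move=> nS; near=> n; have Hn : forall w, (setT `\` B) w -> `|Z n w - z| <= e.
  by near: n; exact: nS.
exists (~` B); split; first exact: measurableC.
  by rewrite setCK ltW.
by move=> w Bw; apply: Hn; rewrite setTD.
Unshelve. all: by end_near. Qed.

(** Chebyshev's inequality, applied once [v n <= eta * e ^+ 2]. *)
Lemma mean_sqr_cvg_in_prob Z z (v : nat -> R) :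
  (forall n, (0 < n)%N -> measurable_fun setT (Z n)) ->
  (forall n, (0 < n)%N -> has_mean P (fun w => (Z n w - z) ^+ 2) (v n)) ->
  v @ \oo --> (0 : R) -> cvg_in_prob Z z.
Proof.
move=> mZ Zv v0 e eta e0 eta0; near=> n.
have n0 : (0 < n)%N by near: n; exact: nbhs_infty_gt.
have vn : v n <= eta * e ^+ 2.
  near: n; move/cvgrPdist_le : v0 => /(_ (eta * e ^+ 2)).
  rewrite mulr_gt0// ?exprn_gt0// => /(_ isT); apply: filterS => m.
  by rewrite sub0r normrN => /(le_trans (ler_norm _)).
have mZ2 : measurable_fun setT (fun w => (Z n w - z) ^+ 2).
  by apply: measurable_funX; apply: measurable_funB => //; exact: mZ.
pose E := [set w | `|Z n w - z| <= e].
have mE : measurable E.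
  have -> : E = (fun w => `|Z n w - z|) @^-1` `]-oo, e].
    by apply/seteqP; split=> w /=; rewrite in_itv.
  rewrite -[X in measurable X]setTI.
  have : measurable_fun setT (fun w => `|Z n w - z|).
    by apply: measurableT_comp => //; apply: measurable_funB => //; exact: mZ.
  by apply => //; exact: measurable_itv.
exists E; split => //.
have [ie eE] := Zv n n0; have e20 : 0 < e ^+ 2 by rewrite exprn_gt0.
rewrite -(@lee_pmul2l _ (e ^+ 2)%:E)//.
apply: (@le_trans _ _ (\int[P]_w `|((Z n w - z) ^+ 2)%:E|)%E).
  apply: le_trans; last first.
    exact: (le_integral_abse P measurableT (measurable_int _ ie) e20).
  apply: lee_wpmul2l; first by rewrite lee_fin ltW.
  apply: le_measure; rewrite ?inE//.
  - exact: measurableC.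
  - by apply: emeasurable_fun_c_infty => //; apply: measurableT_comp => //;
      exact: measurable_int ie.
  - move=> w /= /negP; rewrite -ltNge => ew; split=> //=.
    by rewrite lee_fin normrX; apply: lerXn2r; rewrite ?nnegrE// ltW.
under eq_integral do rewrite gee0_abs ?lee_fin ?sqr_ge0//.
by rewrite eE -EFinM lee_fin mulrC.
Unshelve. all: by end_near. Qed.

End convergence_in_probability.

(** * Quadratic covariation of processes with Lipschitz drift *)

Lemma cvg_divn (R : realType) (c : R) :
  (fun n : nat => c / n%:R) @ \oo --> (0 : R).
Proof.
rewrite -[X in _ --> X](mulr0 c); apply: cvgM; first exact: cvg_cst.
apply: (gtr0_cvgV0 _).2; last exact: cvgr_idn.
by near=> n; rewrite ltr0n; near: n; exact: nbhs_infty_gt.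
Unshelve. all: by end_near. Qed.

Section quadratic_covariation.
Context d (Omega : measurableType d) (R : realType) (P : probability Omega R).
Variables (T : R) (T0 : 0 < T).
Implicit Types U V D : R -> Omega -> R.

Definition qcov U V (n : nat) (w : Omega) : R :=
  \sum_(1 <= i < n.+1) grid_incr T n U i w * grid_incr T n V i w.

(** The constant [K] may depend on the path, with no control on its law. *)
Definition ae_lipschitz D : Prop :=
  {ae P, forall w, exists K : R, forall s t : R, 0 <= s -> s <= t -> t <= T ->
     `|D t w - D s w| <= K * (t - s)}.

Lemma grid_in (n i : nat) : (i <= n)%N -> 0 <= i%:R * (T / n%:R) <= T.
Proof.
case: n => [|n] in_.
  by move: in_; rewrite leqn0 => /eqP->; rewrite mul0r lexx ltW.
rewrite mulr_ge0 ?divr_ge0 ?(ltW T0)//= mulrCA ger_pMr//.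
by rewrite ler_pdivrMr ?ltr0n// mul1r ler_nat.
Qed.

Lemma measurable_qcov U V n :
  (forall t, 0 <= t <= T -> measurable_fun setT (U t)) ->
  (forall t, 0 <= t <= T -> measurable_fun setT (V t)) ->
  measurable_fun setT (qcov U V n).
Proof.
move=> mU mV; rewrite /qcov.
(* Ordinal indices carry [i < n], which keeps the grid times in [[0, T]], where measurability is
   given. *)
rewrite (_ : (fun w => _) = (fun w => \sum_(i < n)
    grid_incr T n U i.+1 w * grid_incr T n V i.+1 w)); last first.
  by apply/funext => w; rewrite big_add1 /= big_mkord.
apply: measurable_sum => i; apply: measurable_funM;
  by apply: measurable_funB; (apply: mU || apply: mV); apply: grid_in;
    [exact: ltn_ord|exact: ltnW (ltn_ord i)].
Qed.

Lemma qcov_brownian (W : R -> Omega -> R) : brownian_motion P W ->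
  cvg_in_prob P (qcov W W) T.
Proof.
move=> hW; have mW t : 0 <= t <= T -> measurable_fun setT (W t).
  by case/andP=> t0 _; case: hW => + _ _ _ _; exact.
apply: (mean_sqr_cvg_in_prob (v := fun n => 2 * T ^+ 2 / n%:R)).
- by move=> n _; exact: measurable_qcov.
- move=> n n0; have := mean_quad_variation T0 n0 hW; congr has_mean.
  by rewrite -mulr_natr; field; rewrite pnatr_eq0 -lt0n.
- exact: cvg_divn.
Qed.

Lemma qcov_brownian_indep (W W' : R -> Omega -> R) :
  brownian_motion P W -> brownian_motion P W' ->
  (forall A B, sigma_gen `[0, +oo[ W A -> sigma_gen `[0, +oo[ W' B ->
     P (A `&` B) = (P A * P B)%E) ->
  cvg_in_prob P (qcov W W') 0.
Proof.
move=> hW hW' WW'; have mW V t : brownian_motion P V -> 0 <= t <= T ->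
    measurable_fun setT (V t).
  by move=> hV /andP[t0 _]; case: hV => + _ _ _ _; exact.
apply: (mean_sqr_cvg_in_prob (v := fun n => T ^+ 2 / n%:R)).
- by move=> n _; apply: measurable_qcov => t; exact: mW.
- move=> n n0; have := mean_quad_covariation T0 n0 hW hW' WW'.
  congr has_mean; first by apply/funext => w; rewrite subr0.
  by rewrite -mulr_natr; field; rewrite pnatr_eq0 -lt0n.
- exact: cvg_divn.
Qed.

Lemma qcov_lipschitz D : (forall t, 0 <= t <= T -> measurable_fun setT (D t)) ->
  ae_lipschitz D -> cvg_in_prob P (qcov D D) 0.
Proof.
move=> mD lipD; apply: ae_cvg_in_prob.
  by move=> n; exact: measurable_qcov.
apply: filterS lipD => w [K lipw].
(* The sum of [n] squared increments, each at most [(K T / n)^2]. *)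
have b0 : (fun n : nat => K ^+ 2 * T ^+ 2 * n%:R^-1) @ \oo --> (0 : R).
  exact: cvg_divn.
apply: (squeeze_cvgr _ (cvg_cst 0) b0); near=> n.
have n0 : (0 < n)%N by near: n; exact: nbhs_infty_gt.
apply/andP; split; first by apply: sumr_ge0 => i _; rewrite -expr2 sqr_ge0.
pose h := T / n%:R.
apply: (@le_trans _ _ (\sum_(1 <= i < n.+1) (K * h) ^+ 2)).
  rewrite /qcov big_nat_cond [leRHS]big_nat_cond.
  apply: ler_sum => i; rewrite andbT => /andP[i0]; rewrite ltnS => in_.
  have hi : i%:R * h - i.-1%:R * h = h.
    by case: i i0 {in_} => // i _; rewrite -mulrBl -natrB//= subSnn mul1r.
  have h0 : 0 <= h by rewrite divr_ge0// ltW.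
  have /andP[t0 _] := grid_in (leq_trans (leq_pred i) in_).
  have /andP[_ tT] := grid_in in_.
  have /(lipw _ _ t0)/(_ tT) : i.-1%:R * h <= i%:R * h.
    by rewrite ler_wpM2r// ler_nat leq_pred.
  rewrite hi => Hi; rewrite -expr2 -[leLHS]ger0_norm ?sqr_ge0// normrX.
  by apply: lerXn2r => //; rewrite nnegrE (le_trans _ Hi).
rewrite sumr_const_nat subSS subn0 -[leLHS]mulr_natr /h le_eqVlt; apply/orP; left.
by apply/eqP; field; rewrite pnatr_eq0 -lt0n.
Unshelve. all: by end_near. Qed.

(* AM-GM: |u v| <= s u^2 + v^2 / s for every s > 0. *)
Lemma qcov_cross D V v : cvg_in_prob P (qcov D D) 0 ->
  cvg_in_prob P (qcov V V) v -> cvg_in_prob P (qcov D V) 0.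
Proof.
apply: cvg_in_prob_bound2 => e e0.
(* This weight makes both [s * (e / (2 * s))] and [s^-1 * (|v| + 1)] equal to [e / 2]; the 1 in the
   minimum below keeps [qcov V V] under [|v| + 1]. *)
pose s := 2 * (`|v| + 1) / e.
have v0 : 0 < `|v| + 1 by rewrite ltr_wpDl.
have s0 : 0 < s by rewrite divr_gt0// mulr_gt0.
exists (Num.min 1 (e / (2 * s))).
  by rewrite lt_min ltr01 divr_gt0// mulr_gt0.
apply: nearW => n w; rewrite !subr0 !le_min => /andP[_ HD] /andP[HV _].
have HD' : qcov D D n w <= e / (2 * s) by exact: le_trans (ler_norm _) HD.
have HV' : qcov V V n w <= `|v| + 1.
  rewrite -[qcov _ _ _ _](subrK v) addrC lerD ?ler_norm//.
  exact: le_trans (ler_norm _) HV.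
apply: (@le_trans _ _ (s * qcov D D n w + s^-1 * qcov V V n w)).
  rewrite /qcov 2!mulr_sumr -big_split/= (le_trans (ler_norm_sum _ _ _))//.
  apply: ler_sum => i _; set a := grid_incr _ _ D _ _.
  set b := grid_incr _ _ V _ _.
  have s1 : s * s^-1 = 1 by rewrite divff// gt_eqF.
  have sV : 0 < s^-1 by rewrite invr_gt0.
  have : 0 <= s^-1 * (s * a - b) ^+ 2 by rewrite mulr_ge0 ?sqr_ge0 ?ltW.
  have : 0 <= s^-1 * (s * a + b) ^+ 2 by rewrite mulr_ge0 ?sqr_ge0 ?ltW.
  have -> : s^-1 * (s * a - b) ^+ 2 = s * (a * a) + s^-1 * (b * b) - 2 * (a * b).
    by field; rewrite gt_eqF.
  have -> : s^-1 * (s * a + b) ^+ 2 = s * (a * a) + s^-1 * (b * b) + 2 * (a * b).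
    by field; rewrite gt_eqF.
  have : 0 <= s * (a * a) by rewrite mulr_ge0 ?(ltW s0)// -expr2 sqr_ge0.
  have : 0 <= s^-1 * (b * b) by rewrite mulr_ge0 ?(ltW sV)// -expr2 sqr_ge0.
  by move=> *; rewrite ler_norml; apply/andP; split; lra.
have -> : e = s * (e / (2 * s)) + s^-1 * (`|v| + 1).
  by rewrite /s; field; rewrite !gt_eqF.
by rewrite lerD// ler_wpM2l// ?invr_ge0 ltW.
Qed.

(** Write [X i = D i + V i] with [V i] the Brownian combination. By bilinearity [qcov] splits into
    four terms; those containing a [D] vanish in the limit, and in the remaining one only the
    diagonal pairs [a = b] survive, each with limit [T]. *)
Lemma cvg_in_prob_qcov_ito (I : finType) (p : nat) (W : I -> R -> Omega -> R)
    (N : 'I_p -> I -> R) (X : 'I_p -> R -> Omega -> R) :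
  (forall a, brownian_motion P (W a)) ->
  (forall a b A B, a != b -> sigma_gen `[0, +oo[ (W a) A ->
     sigma_gen `[0, +oo[ (W b) B -> P (A `&` B) = (P A * P B)%E) ->
  (forall i t, 0 <= t <= T -> measurable_fun setT (X i t)) ->
  (forall i, ae_lipschitz (fun t w => X i t w - \sum_a N i a * W a t w)) ->
  forall i j, cvg_in_prob P (fun n w => T^-1 * qcov (X i) (X j) n w)
    (\sum_a N i a * N j a).
Proof.
move=> hW indepW mX lipX i j.
pose V i (t : R) w := \sum_a N i a * W a t w.
pose D i (t : R) w := X i t w - V i t w.
have mV i' t : 0 <= t <= T -> measurable_fun setT (V i' t).
  move=> /andP[t0 _]; apply: measurable_sum => a; apply: measurable_funM => //.
  by case: (hW a) => + _ _ _ _; exact.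
have mD i' t : 0 <= t <= T -> measurable_fun setT (D i' t).
  by move=> t0T; apply: measurable_funB; [exact: mX|exact: mV].
have DD i' := qcov_lipschitz (mD i') (lipX i').
have VV i' j' : cvg_in_prob P (qcov (V i') (V j')) (T * \sum_a N i' a * N j' a).
  have : cvg_in_prob P
      (fun n w => \sum_a \sum_b N i' a * N j' b * qcov (W a) (W b) n w)
      (\sum_a \sum_b N i' a * N j' b * (if a == b then T else 0)).
    apply: cvg_in_prob_sum => a; apply: cvg_in_prob_sum => b; apply: cvg_in_probZ.
    have [<-|ab] := eqVneq; first exact: qcov_brownian.
    by apply: qcov_brownian_indep => // A B; exact: indepW.
  congr cvg_in_prob.
    apply/funext => n; apply/funext => w; rewrite /qcov.
    under eq_bigr do under eq_bigr do rewrite mulr_sumr.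
    under eq_bigr do rewrite exchange_big/=.
    rewrite exchange_big/=; apply: eq_bigr => k _.
    rewrite /grid_incr /increment /V -!sumrB big_distrlr/=.
    apply: eq_bigr => a _; apply: eq_bigr => b _.
    ring.
  rewrite mulr_sumr; apply: eq_bigr => a _.
  rewrite (bigD1 a)//= eqxx big1 ?addr0; first by rewrite mulrC.
  by move=> b ba; rewrite eq_sym (negPf ba) mulr0.
have DV i' j' := qcov_cross (DD i') (VV j' j').
have DDij := qcov_cross (DD i) (DD j).
have := cvg_in_probZ T^-1 (cvg_in_probD (cvg_in_probD DDij (DV i j))
  (cvg_in_probD (DV j i) (VV i j))).
rewrite !add0r mulKf ?gt_eqF//; congr cvg_in_prob.
apply/funext => n; apply/funext => w; congr (_ * _).
rewrite /qcov -!big_split/=; apply: eq_bigr => k _.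
by rewrite /grid_incr /increment /D; ring.
Qed.

End quadratic_covariation.

(** * Lipschitz remainder of the solution paths *)

Lemma integral_lipschitz (R : realType) (T : R) (f : R -> R) :
  0 < T -> {within `[0, T], continuous f} ->
  exists K : R, forall s t : R, 0 <= s -> s <= t -> t <= T ->
    `|\int[lebesgue_measure]_(x in `[0, t]) f x -
      \int[lebesgue_measure]_(x in `[0, s]) f x| <= K * (t - s).
Proof.
move=> T0 cf; have cnf : {within `[0, T], continuous (fun x => `|f x|)}.
  by move=> x; apply: (continuous_comp (cf x)); exact: norm_continuous.
(* The maximum of [|f|] over [[0, T]] serves as Lipschitz constant of the primitive. *)
have [c _ Hc] := EVT_max (ltW T0) cnf.
exists `|f c| => s t s0 st tT.
have ift : lebesgue_measure.-integrable `[0, t] (EFin \o f).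
  apply: continuous_compact_integrable; first exact: segment_compact.
  apply: continuous_subspaceW cf => x /=; rewrite !in_itv/= => /andP[-> /=].
  by move=> /le_trans; apply.
rewrite Rintegral_itvB//.
have ist : lebesgue_measure.-integrable `]s, t] (EFin \o f).
  apply: integrableS ift => //= x /=; rewrite !in_itv/= => /andP[sx ->].
  by rewrite (le_trans s0 (ltW sx)).
apply: le_trans (le_normr_Rintegral _ ist) _ => //.
have icst' : lebesgue_measure.-integrable `[s, t] (EFin \o (fun=> `|f c|)).
  apply: continuous_compact_integrable; first exact: segment_compact.
  by apply: continuous_subspaceT => x; exact: cvg_cst.
have icst : lebesgue_measure.-integrable `]s, t] (EFin \o (fun=> `|f c|)).
  apply: integrableS icst' => // x /=.
  by rewrite !in_itv/= => /andP[/ltW -> ->].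
apply: (@le_trans _ _ (\int[lebesgue_measure]_(x in `]s, t]) `|f c|)).
  apply: le_Rintegral => //.
    by have := integrable_norm ist.
  move=> x /=; rewrite in_itv/= => /andP[sx xt]; apply: Hc.
  by rewrite in_itv/= (le_trans s0 (ltW sx)) (le_trans xt tT).
rewrite Rintegral_cst//= lebesgue_measure_itv/=.
by case: ifPn => // _; rewrite ?lte_fin//= mulr0 mulr_ge0 ?subr_ge0.
Qed.

Section drift_part.
Context d (Omega : measurableType d) (R : realType) (P : probability Omega R).
Variables (T : R) (T0 : 0 < T).
Notation ae_lipschitz := (ae_lipschitz P T).

(** Without its noise term the equation leaves the initial value plus a time integral, whose
    integrand is continuous along almost every path. *)
Lemma ae_lipschitz_sde k r (B : 'cV[R]_k -> 'cV[R]_k) (S : 'M[R]_(k, r)) c W Y i :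
  sde_solution P T B S c W Y -> continuous B ->
  ae_lipschitz (fun t w => Y t w i ord0 - \sum_j S i j * W t w j ord0).
Proof.
move=> [_ cY EY] cB; apply: filterS2 cY EY => w cYw EYw.
pose f s := B (Y s w) i ord0.
have cBY : {within `[0, T], continuous (fun t => B (Y t w))}.
  by move=> x; exact: (continuous_comp (cYw x) (cB (Y x w))).
have cf : {within `[0, T], continuous f}.
  move=> x.
  exact: (continuous_comp (cBY x) (@coord_continuous R k 1 i ord0 (B (Y x w)))).
have [K HK] := integral_lipschitz T0 cf; exists K => s t s0 st tT.
have E u : 0 <= u <= T -> Y u w i ord0 - \sum_j S i j * W u w j ord0
    = c i ord0 + \int[lebesgue_measure]_(x in `[0, u]) f x.
  by move=> /EYw ->; rewrite !mxE addrK.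
rewrite !E ?s0 ?(le_trans st)// ?tT ?(le_trans s0)//.
by rewrite opprD addrACA subrr add0r; exact: HK.
Qed.

Lemma ae_lipschitzD D1 D2 : ae_lipschitz D1 -> ae_lipschitz D2 ->
  ae_lipschitz (fun t w => D1 t w + D2 t w).
Proof.
apply: filterS2 => w [K1 H1] [K2 H2]; exists (K1 + K2) => s t s0 st tT.
rewrite opprD addrACA mulrDl (le_trans (ler_normD _ _))//.
by rewrite lerD ?H1 ?H2.
Qed.

Lemma ae_lipschitzZ k D : ae_lipschitz D -> ae_lipschitz (fun t w => k * D t w).
Proof.
apply: filterS => w [K H]; exists (`|k| * K) => s t s0 st tT.
by rewrite -mulrBr normrM -mulrA ler_wpM2l// H.
Qed.

Lemma ae_lipschitz_sum (I : Type) (r : seq I) (D : I -> R -> Omega -> R) :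
  (forall i, ae_lipschitz (D i)) ->
  ae_lipschitz (fun t w => \sum_(i <- r) D i t w).
Proof.
move=> H; elim: r => [|i r IHr].
  apply: aeW => w; exists 0 => s t *.
  by rewrite !big_nil subrr normr0 mul0r.
have := ae_lipschitzD (H i) IHr; apply: filterS => w [K HK].
by exists K => s t *; rewrite !big_cons; exact: HK.
Qed.

Lemma ae_lipschitz_ext D D' :
  (forall t w, 0 <= t <= T -> D t w = D' t w) ->
  ae_lipschitz D -> ae_lipschitz D'.
Proof.
move=> DD'; apply: filterS => w [K H]; exists K => s t s0 st tT.
rewrite -!DD' ?s0 ?(le_trans st)// ?tT ?(le_trans s0)//.
exact: H.
Qed.

End drift_part.

(** * Uniform positivity of the contrast *)

(* [L f a] is meant to be either convergence of [f] to [a] along a filter, or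
   measurability of [f], with [a] irrelevant. *)
Record stable_relation (R : realType) (I : Type) (D : set I)
    (L : (I -> R) -> R -> Prop) : Prop := StableRelation {
  stable_cst : forall c, L (fun=> c) c;
  stable_add : forall f g a b, L f a -> L g b -> L (fun x => f x + g x) (a + b);
  stable_mul : forall f g a b, L f a -> L g b -> L (fun x => f x * g x) (a * b);
  stable_inv : forall f a, a != 0 -> L f a -> L (fun x => (f x)^-1) a^-1;
  stable_ln : forall f a, 0 < a -> L f a -> L (fun x => ln (f x)) (ln a);
  stable_eq : forall f g a, (forall x, D x -> f x = g x) -> L f a -> L g a }.

Section stable_matrix.
Variables (R : realType) (I : Type) (D : set I) (L : (I -> R) -> R -> Prop).
Hypothesis sL : stable_relation D L.

Definition stable_mx m n (F : I -> 'M[R]_(m, n)) (A : 'M[R]_(m, n)) : Prop :=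
  forall i j, L (fun x => F x i j) (A i j).

Lemma stable_eqf f g a : f =1 g -> L f a -> L g a.
Proof. by move=> fg; apply: (stable_eq sL) => x _; exact: fg. Qed.

Lemma stable_sum (J : Type) (r : seq J) (f : J -> I -> R) (a : J -> R) :
  (forall j, L (f j) (a j)) ->
  L (fun x => \sum_(j <- r) f j x) (\sum_(j <- r) a j).
Proof.
move=> H; elim: r => [|j r IHr].
  rewrite big_nil; apply: stable_eqf (stable_cst sL 0) => x.
  by rewrite big_nil.
rewrite big_cons; apply: stable_eqf (stable_add sL (H j) IHr) => x.
by rewrite big_cons.
Qed.

Lemma stable_prod (J : Type) (r : seq J) (f : J -> I -> R) (a : J -> R) :
  (forall j, L (f j) (a j)) ->
  L (fun x => \prod_(j <- r) f j x) (\prod_(j <- r) a j).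
Proof.
move=> H; elim: r => [|j r IHr].
  rewrite big_nil; apply: stable_eqf (stable_cst sL 1) => x.
  by rewrite big_nil.
rewrite big_cons; apply: stable_eqf (stable_mul sL (H j) IHr) => x.
by rewrite big_cons.
Qed.

Lemma stable_addmx m n F G (A B : 'M[R]_(m, n)) : stable_mx F A ->
  stable_mx G B -> stable_mx (fun x => F x + G x) (A + B).
Proof.
move=> HF HG i j; rewrite mxE.
by apply: stable_eqf (stable_add sL (HF i j) (HG i j)) => x; rewrite mxE.
Qed.

Lemma stable_mulmx m n p F G (A : 'M[R]_(m, n)) (B : 'M[R]_(n, p)) :
  stable_mx F A -> stable_mx G B -> stable_mx (fun x => F x *m G x) (A *m B).
Proof.
move=> HF HG i j; rewrite mxE.
have := stable_sum (index_enum _) (fun k => stable_mul sL (HF i k) (HG k j)).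
by apply: stable_eqf => x; rewrite mxE.
Qed.

Lemma stable_trmx m n F (A : 'M[R]_(m, n)) :
  stable_mx F A -> stable_mx (fun x => (F x)^T) A^T.
Proof.
by move=> HF i j; rewrite mxE; apply: stable_eqf (HF j i) => x; rewrite mxE.
Qed.

Lemma stable_block_mx m n p q F G H K (A : 'M[R]_(m, n)) (B : 'M[R]_(m, q))
    (C : 'M[R]_(p, n)) (E : 'M[R]_(p, q)) :
  stable_mx F A -> stable_mx G B -> stable_mx H C -> stable_mx K E ->
  stable_mx (fun x => block_mx (F x) (G x) (H x) (K x)) (block_mx A B C E).
Proof.
move=> HF HG HH HK i j; rewrite mxE.
case Ei: (fintype.split i) => [i'|i']; rewrite mxE;
  case Ej: (fintype.split j) => [j'|j'].
- by apply: stable_eqf (HF i' j') => x; rewrite mxE Ei mxE Ej.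
- by apply: stable_eqf (HG i' j') => x; rewrite mxE Ei mxE Ej.
- by apply: stable_eqf (HH i' j') => x; rewrite mxE Ei mxE Ej.
- by apply: stable_eqf (HK i' j') => x; rewrite mxE Ei mxE Ej.
Qed.

(** The Leibniz expansion uses only sums, products and constants. *)
Lemma stable_det n F (A : 'M[R]_n) :
  stable_mx F A -> L (fun x => \det (F x)) (\det A).
Proof.
move=> HF; apply: stable_sum => s; apply: (stable_mul sL).
  exact: (stable_cst sL).
by apply: stable_prod => i; exact: HF.
Qed.

Lemma stable_mxtrace n F (A : 'M[R]_n) :
  stable_mx F A -> L (fun x => \tr (F x)) (\tr A).
Proof. by move=> HF; apply: stable_sum => i; exact: HF. Qed.

(** Cramer's rule. Invertibility on [D] matters because [invmx] returns a singular matrix unchanged,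
    and the adjugate formula holds only for units. *)
Lemma stable_invmx n F (A : 'M[R]_n) : stable_mx F A -> A \in unitmx ->
  (forall x, D x -> F x \in unitmx) -> stable_mx (fun x => invmx (F x)) (invmx A).
Proof.
move=> HF Au Fu i j; rewrite /invmx Au mxE.
have dA : \det A != 0 by rewrite -unitfE -unitmxE.
apply: (stable_eq sL (f := fun x => (\det (F x))^-1 * \adj (F x) i j)).
  by move=> x Dx; rewrite (Fu x Dx) [RHS]mxE.
apply: (stable_mul sL); first exact/(stable_inv sL)/stable_det.
rewrite mxE; apply: (stable_eqf (f := fun x => (-1) ^+ (j + i) *
  \det (row' j (col' i (F x))))).
  by move=> x; rewrite mxE.
apply: (stable_mul sL); first exact: (stable_cst sL).
apply: stable_det => k l; rewrite !mxE.
by apply: stable_eqf (HF _ _) => x; rewrite !mxE.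
Qed.

Lemma stable_F_contrast p F G (Q S : 'M[R]_p) : stable_mx F Q ->
  stable_mx G S -> 0 < \det Q -> 0 < \det S ->
  (forall x, D x -> G x \in unitmx) ->
  L (fun x => F_contrast (F x) (G x)) (F_contrast Q S).
Proof.
move=> HF HG Q0 S0 Gu.
have Su : S \in unitmx by rewrite unitmxE unitfE gt_eqF.
have lnS := stable_ln sL S0 (stable_det HG).
have lnQ := stable_ln sL Q0 (stable_det HF).
have tr := stable_mxtrace (stable_mulmx (stable_invmx HG Su Gu) HF).
have := stable_add sL (stable_add sL (stable_add sL lnS
  (stable_mul sL (stable_cst sL (-1)) lnQ)) tr) (stable_cst sL (- p%:R)).
by rewrite !mulN1r; apply: stable_eqf => x; rewrite mulN1r.
Qed.

Lemma stable_Sigma_sem p1 p2 k1 k2 (M : I -> sem R p1 p2 k1 k2) m :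
  stable_mx (fun x => Lambda_x1 (M x)) (Lambda_x1 m) ->
  stable_mx (fun x => Lambda_x2 (M x)) (Lambda_x2 m) ->
  stable_mx (fun x => Gamma_mx (M x)) (Gamma_mx m) ->
  stable_mx (fun x => Psi_mx (M x)) (Psi_mx m) ->
  stable_mx (fun x => Sigma_xixi (M x)) (Sigma_xixi m) ->
  stable_mx (fun x => Sigma_deltadelta (M x)) (Sigma_deltadelta m) ->
  stable_mx (fun x => Sigma_epseps (M x)) (Sigma_epseps m) ->
  stable_mx (fun x => Sigma_zetazeta (M x)) (Sigma_zetazeta m) ->
  Psi_mx m \in unitmx -> (forall x, D x -> Psi_mx (M x) \in unitmx) ->
  stable_mx (fun x => Sigma_sem (M x)) (Sigma_sem m).
Proof.
move=> H1 H2 HG HP Hx Hd He Hz Pu PuD.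
have HV := stable_invmx HP Pu PuD.
have H12 : stable_mx (fun x => Sigma12 (M x)) (Sigma12 m).
  by do 3![apply: stable_mulmx; last exact: stable_trmx]; exact: stable_mulmx.
apply: stable_block_mx; [|exact: H12|exact: stable_trmx|].
  apply: stable_addmx => //; apply: stable_mulmx; last exact: stable_trmx.
  exact: stable_mulmx.
apply: stable_addmx => //; apply: stable_mulmx; last exact: stable_trmx.
apply: stable_mulmx; last exact: stable_trmx.
apply: stable_mulmx; first exact: stable_mulmx.
apply: stable_addmx => //; apply: stable_mulmx; last exact: stable_trmx.
exact: stable_mulmx.
Qed.

End stable_matrix.

Section stable_instances.
Variable R : realType.

Lemma stable_cvg (I : Type) (D : set I) (F : set_system I) : Filter F -> F D ->
  stable_relation D (fun f (a : R) => f x @[x --> F] --> a).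
Proof.
move=> FF FD; split.
- by move=> c; exact: cvg_cst.
- by move=> f g a b fa gb; exact: (@cvgD _ R^o).
- by move=> f g a b fa gb; exact: cvgM.
- by move=> f a a0 fa; exact: cvgV.
- move=> f a a0 fa; apply: (cvg_comp _ _ fa); exact: continuous_ln.
- move=> f g a fg; apply: cvg_trans; apply: near_eq_cvg.
  by apply: filterS FD => x /fg.
Qed.

(** [x^-1 = x * exp (- ln (x^2))], also at 0, where the factor [x] matches the convention
    [0^-1 = 0]. *)
Lemma measurable_invr : measurable_fun setT (@GRing.inv R).
Proof.
rewrite (_ : GRing.inv = fun x : R => x * expR (- ln (x ^+ 2))).
  apply: measurable_funM => //; apply: measurableT_comp => //.
  apply: measurableT_comp => //; apply: measurableT_comp.
    exact: measurable_ln.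
  exact: exprn_measurable.
apply/funext => x; have [->|x0] := eqVneq x 0; first by rewrite invr0 mul0r.
by rewrite expRN lnK ?posrE ?exprn_even_gt0// expr2 invfM mulrA divff// mul1r.
Qed.

Lemma stable_measurable d (T : measurableType d) :
  stable_relation setT (fun (f : T -> R) (_ : R) => measurable_fun setT f).
Proof.
split.
- by move=> c; exact: measurable_cst.
- by move=> f g _ _; exact: measurable_funD.
- by move=> f g _ _; exact: measurable_funM.
- by move=> f _ _ mf; exact: (measurableT_comp measurable_invr mf).
- by move=> f _ _ mf; apply: (@measurableT_comp _ _ _ _ _ _ (@ln R)) => //.
- by move=> f g _ fg; congr measurable_fun; apply/funext => x; rewrite fg.
Qed.

End stable_instances.

(** * The covariance as a function of the parameter, and compactness *)

Section parametric_model.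
Variables (R : realType) (p1 p2 k1 k2 q : nat) (Theta : set 'rV[R]_q).
Variable M : 'rV[R]_q -> sem R p1 p2 k1 k2.
Hypothesis hM : parametric_sem Theta M.

Lemma pd_Sigma_model theta : Theta theta -> pd (Sigma_sem (M theta)).
Proof.
case: hM => adm _ _ _ /adm[_ _ [? ?] [? ?]]; exact: pd_Sigma_sem.
Qed.

Lemma stable_known_or_coordinate (I : Type) (D : set I)
    (L : (I -> R) -> R -> Prop) (th : I -> 'rV[R]_q) th0 a b
    (N : 'rV[R]_q -> 'M[R]_(a, b)) :
  stable_relation D L -> (forall x, D x -> Theta (th x)) -> Theta th0 ->
  (forall l, L (fun x => th x ord0 l) (th0 ord0 l)) ->
  known_or_coordinate Theta N -> stable_mx L (fun x => N (th x)) (N th0).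
Proof.
move=> sL DT T0 Lth kN i j; have [[c Nc]|[l Nl]] := kN i j.
  rewrite Nc//; apply: (stable_eq sL) (stable_cst sL c) => x /DT Tx.
  by rewrite Nc.
by rewrite Nl//; apply: (stable_eq sL) (Lth l) => x /DT Tx; rewrite Nl.
Qed.

Lemma stable_Sigma_model (I : Type) (D : set I)
    (L : (I -> R) -> R -> Prop) (th : I -> 'rV[R]_q) th0 :
  stable_relation D L -> (forall x, D x -> Theta (th x)) -> Theta th0 ->
  (forall l, L (fun x => th x ord0 l) (th0 ord0 l)) ->
  stable_mx L (fun x => Sigma_sem (M (th x))) (Sigma_sem (M th0)).
Proof.
move=> sL DT T0 Lth; have [adm [? ? ? ?] [? ? ? ?] _] := hM.
have kc a b N := @stable_known_or_coordinate I D L th th0 a b N sL DT T0 Lth.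
have Pu theta : Theta theta -> Psi_mx (M theta) \in unitmx.
  by move=> /adm[_ [_ +] _ _].
apply: (stable_Sigma_sem sL (M := M \o th)); [exact: kc (fun t => Lambda_x1 (M t)) _
  |exact: kc (fun t => Lambda_x2 (M t)) _|exact: kc (fun t => Gamma_mx (M t)) _
  |exact: kc (fun t => Psi_mx (M t)) _|exact: kc (fun t => Sigma_xixi (M t)) _
  |exact: kc (fun t => Sigma_deltadelta (M t)) _
  |exact: kc (fun t => Sigma_epseps (M t)) _
  |exact: kc (fun t => Sigma_zetazeta (M t)) _|exact: Pu|].
by move=> x /DT; exact: Pu.
Qed.

(** Near each [theta] of [Theta] the bound follows from continuity and [F_contrast_gt0]; the
    near-covering form of compactness makes the neighbourhood of [S0] and the threshold common to
    all [theta]. *)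
Lemma F_contrast_lower_bound (S0 : 'M[R]_(p1 + p2)) : compact Theta -> pd S0 ->
  (forall theta, Theta theta -> S0 <> Sigma_sem (M theta)) ->
  exists e c0 : R, [/\ 0 < e, 0 < c0 &
    forall (Q : 'M[R]_(p1 + p2)) theta, Theta theta ->
    (forall i j, `|Q i j - S0 i j| <= e) ->
    Q \in unitmx /\ c0 < F_contrast Q (Sigma_sem (M theta))].
Proof.
move=> /compact_near_coveringP/near_covering_withinP cT pS0 H1.
pose G : set_system ('M[R]_(p1 + p2) * R) := nbhs (S0, 0 : R).
(* The threshold is a second variable [z.2] tending to 0, so that one covering argument yields both
   [e] and [c0]. *)
pose Pr (z : 'M[R]_(p1 + p2) * R) theta :=
  z.1 \in unitmx /\ z.2 < F_contrast z.1 (Sigma_sem (M theta)).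
have : \near G, Theta `<=` Pr G.
  apply: cT => th0 Tth0.
  pose D := [set z : 'rV[R]_q * ('M[R]_(p1 + p2) * R) | Theta z.1].
  pose FF := within D (filter_prod (nbhs th0) G).
  have FD : FF D by apply: withinT.
  have FFF : Filter FF by exact: within_filter.
  have sL : stable_relation D (fun f (a : R) => f x @[x --> FF] --> a).
    exact: stable_cvg.
  have c1 : z.1 @[z --> FF] --> th0 by apply: cvg_within_filter; exact: cvg_fst.
  have c2 : z.2 @[z --> FF] --> (S0, 0 : R).
    by apply: cvg_within_filter; exact: cvg_snd.
  have c21 : z.2.1 @[z --> FF] --> S0.
    exact: (cvg_comp _ _ c2 cvg_fst).
  have c22 : z.2.2 @[z --> FF] --> (0 : R).
    exact: (cvg_comp _ _ c2 cvg_snd).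
  have HQ : stable_mx (fun f (a : R) => f z @[z --> FF] --> a)
      (fun z : 'rV[R]_q * ('M[R]_(p1 + p2) * R) => z.2.1) S0.
    move=> i j; apply: (cvg_comp _ (fun A : 'M[R]_(p1 + p2) => A i j) c21).
    exact: coord_continuous.
  have HS : stable_mx (fun f (a : R) => f z @[z --> FF] --> a)
      (fun z => Sigma_sem (M z.1)) (Sigma_sem (M th0)).
    apply: (stable_Sigma_model sL) => // l.
    apply: (cvg_comp _ (fun t : 'rV[R]_q => t ord0 l) c1).
    exact: coord_continuous.
  have pS := pd_Sigma_model Tth0.
  have HF : F_contrast z.2.1 (Sigma_sem (M z.1)) - z.2.2 @[z --> FF] -->
      F_contrast S0 (Sigma_sem (M th0)) - 0.
    apply: (@cvgB _ R^o) => //.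
    apply: (stable_F_contrast sL HQ HS (pd_det_gt0 pS0) (pd_det_gt0 pS)).
    by move=> z /pd_Sigma_model/pd_unitmx.
  have Hdet : \det z.2.1 @[z --> FF] --> \det S0 := stable_det sL HQ.
  have F0 := F_contrast_gt0 pS0 pS (H1 _ Tth0).
  have near1 : \forall z \near FF,
      0 < F_contrast z.2.1 (Sigma_sem (M z.1)) - z.2.2.
    by apply: (cvgr_gt _ HF); rewrite subr0.
  have near2 : \forall z \near FF, 0 < \det z.2.1.
    by apply: (cvgr_gt _ Hdet); exact: pd_det_gt0.
  have : \forall z \near FF, Pr z.2 z.1.
    apply: filterS2 near1 near2 => z z1 z2; split; last by rewrite -subr_gt0.
    by rewrite unitmxE unitfE gt_eqF.
  by [].
move=> [[A B] /= [nA nB] AB].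
have [e /= e0 eA] := (nbhs_ballP S0 A).1 nA.
have [c /= c0 cB] := (nbhs_ballP (0 : R) B).1 nB.
(* Halving turns the non-strict entrywise bound into membership in an open ball, and picks a
   positive threshold close to 0. *)
exists (e / 2), (c / 2); split; rewrite ?divr_gt0// => Q theta Tth QS.
have [] // := AB (Q, c / 2) _ theta Tth.
split => /=.
  apply: eA; split => // i j; rewrite /ball/= distrC (le_lt_trans (QS i j))//.
  by rewrite ltr_pdivrMr// ltr_pMr// ltr1n.
apply: cB; rewrite /ball/= sub0r normrN gtr0_norm ?divr_gt0//.
by rewrite ltr_pdivrMr// ltr_pMr// ltr1n.
Qed.

End parametric_model.

(** * Measurability of the contrast *)

Section measurability.
Context d (T : measurableType d) (R : realType).

Definition measurable_mx m n (F : T -> 'M[R]_(m, n)) : Prop :=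
  forall i j, measurable_fun setT (fun w => F w i j).

(** The enumeration behind [vech] is replayed on index pairs, independently of the matrix; this
    reduces measurability of [vech] to that of entries. *)
Lemma vech_entry p (k : 'I_(vech_dim p)) :
  exists i j, forall A : 'M[R]_p, vech A k ord0 = A i j.
Proof.
pose idx := flatten [seq [seq (i, j)
  | i <- [seq i <- enum 'I_p | (val j <= val i)%N]] | j <- enum 'I_p].
have vE (A : 'M[R]_p) : vech_seq A = [seq A ij.1 ij.2 | ij <- idx].
  rewrite map_flatten -map_comp; congr flatten; apply: eq_map => j /=.
  by rewrite -map_comp.
have kidx : (k < size idx)%N.
  apply: leq_trans (ltn_ord k) _.
  by rewrite -(size_vech_seq (0 : 'M[R]_p)) vE size_map.
case: idx vE kidx => // x0 s vE ks.
exists (nth x0 (x0 :: s) k).1, (nth x0 (x0 :: s) k).2 => A.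
by rewrite mxE vE (nth_map x0).
Qed.

Lemma measurable_quasi_contrast p (Q S : T -> 'M[R]_p) :
  measurable_mx Q -> measurable_mx S -> (forall w, pd (S w)) ->
  measurable_fun setT (fun w => quasi_contrast (Q w) (S w)).
Proof.
move=> mQ mS pS; have sL := stable_measurable R T.
have mdet (F : T -> 'M[R]_p) :
    measurable_mx F -> measurable_fun setT (fun w => \det (F w)).
  by move=> mF; apply: (stable_det sL (F := F) (A := 1%:M)).
apply: measurable_fun_ifT.
- rewrite (_ : (fun w => _) = (fun w => ~~ (\det (Q w) == 0))); last first.
    by apply/funext => w; rewrite unitmxE unitfE.
  by apply: measurable_neg; apply: measurable_fun_eqr => //; exact: mdet.
(* Each branch must be measurable on the whole space, also where [Q] is singular; [ln] and inversion
   are measurable with their default values. The identity matrices are placeholder limits with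
   positive determinant. *)
- apply: (stable_F_contrast sL (F := Q) (G := S) (Q := 1%:M) (S := 1%:M)) => //;
    rewrite ?det1// => w _; exact: pd_unitmx.
- rewrite /enorm (_ : (fun w => _) =
    (fun w => \sum_i (vech (Q w) - vech (S w)) i ord0 ^+ 2)); last first.
    by apply/funext => w; rewrite sqr_sqrtr// sumr_ge0// => i _; exact: sqr_ge0.
  apply: measurable_sum => i; apply: measurable_funX.
  have [a [b ab]] := vech_entry i.
  rewrite (_ : (fun w => _) = (fun w => Q w a b - S w a b)).
    exact: measurable_funB.
  by apply/funext => w; rewrite !mxE -!ab !mxE.
Qed.

End measurability.

(** * The observed process and the test *)

Section probability_lemmas.
Context d (Omega : measurableType d) (R : realType) (P : probability Omega R).

Lemma mutually_independent_pair (I : finType) (G : I -> set_system Omega)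
    (i j : I) A B : mutually_independent P G -> i != j -> G i A -> G j B ->
  P (A `&` B) = (P A * P B)%E.
Proof.
move=> Gind ij GA GB.
have := Gind [set i; j]%SET (fun k => if k == i then A else B).
rewrite !big_setU1 ?inE//= !big_set1 eqxx eq_sym (negPf ij); apply => k.
by rewrite !inE => /orP[]/eqP->; rewrite ?eqxx// eq_sym (negPf ij).
Qed.

(** A single event serves all indices: the sum of the absolute deviations tends to 0 and dominates
    each of them. *)
Lemma cvg_in_prob_family (I : finType) (Z : I -> nat -> Omega -> R) (z : I -> R) :
  (forall i, cvg_in_prob P (Z i) (z i)) ->
  forall e eta : R, 0 < e -> 0 < eta -> \forall n \near \oo,
    exists E, [/\ measurable E, (P (~` E) <= eta%:E)%E &
                  forall w i, E w -> `|Z i n w - z i| <= e].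
Proof.
move=> H e eta e0 eta0.
have Hn i : cvg_in_prob P (fun n w => `|Z i n w - z i|) 0.
  apply: (cvg_in_prob_bound2 _ (H i) (H i)) => e' e'0; exists e' => //.
  by apply: nearW => n w + _; rewrite subr0 normr_id.
have := @cvg_in_prob_sum _ _ _ P I (index_enum I) _ _ Hn e eta e0 eta0.
apply: filterS => n [E [mE PE HE]]; exists E; split=> // w i /HE.
rewrite big1_eq subr0; apply: le_trans; rewrite (le_trans _ (ler_norm _))//.
by rewrite (bigD1 i)//= lerDl sumr_ge0.
Qed.

Lemma cvg_probability1 (A : nat -> set Omega) :
  (forall eta : R, 0 < eta -> \forall n \near \oo,
     measurable (A n) /\ exists E, [/\ measurable E, (P (~` E) <= eta%:E)%E &
       E `<=` A n]) ->
  P (A n) @[n --> \oo] --> 1%E.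
Proof.
move=> HA; apply/fine_cvgP; split.
  apply: filterS (HA 1 ltr01) => n [mA _]; exact: fin_num_measure.
apply/cvgrPdist_le => e e0; apply: filterS (HA e e0) => n [mA [E [mE PE EA]]].
have PA : P (A n) \is a fin_num by exact: fin_num_measure.
have PA1 : fine (P (A n)) <= 1.
  by rewrite -lee_fin fineK//; exact: probability_le1.
rewrite ger0_norm ?subr_ge0//= -lee_fin EFinB fineK// -probability_setC//.
apply: le_trans PE; apply: le_measure; rewrite ?inE;
  [exact: measurableC|exact: measurableC|exact: subsetC].
Qed.

End probability_lemmas.

Lemma psd_gram (R : realType) m n (S : 'M[R]_(m, n)) : psd (S *m S^T).
Proof.
rewrite -[S in S *m _]mulmx1; apply: psd_congr; split; first exact: trmx1.
move=> v; rewrite mulmx1 mxE sumr_ge0// => i _.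
by rewrite mxE -expr2 sqr_ge0.
Qed.

Lemma quad_covE (R : realType) p d (Omega : measurableType d) (T : R) n
    (X : R -> Omega -> 'cV[R]_p) w i j :
  quad_cov T n (fun t => X t w) i j =
  T^-1 * qcov T (fun t w => X t w i ord0) (fun t w => X t w j ord0) n w.
Proof.
rewrite mxE summxE; congr (_ * _); apply: eq_bigr => k _.
by rewrite mxE big_ord1 !mxE.
Qed.

(** * Realized covariance of a linear image of the four latent processes *)

Section observed_process.
Context (R : realType) d (Omega : measurableType d) (P : probability Omega R).
Variables (p1 p2 k1 k2 r1 r2 r3 r4 : nat) (T : R) (T0 : 0 < T).
Variables (W1 : R -> Omega -> 'cV[R]_r1) (W2 : R -> Omega -> 'cV[R]_r2)
  (W3 : R -> Omega -> 'cV[R]_r3) (W4 : R -> Omega -> 'cV[R]_r4).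
Hypotheses (hW1 : wiener_process P W1) (hW2 : wiener_process P W2)
  (hW3 : wiener_process P W3) (hW4 : wiener_process P W4).
Hypothesis hWind : mutually_independent P
  (tnth [tuple process_sigma W1; process_sigma W2;
               process_sigma W3; process_sigma W4]).

Local Notation noise := ('I_r1 + 'I_r2 + 'I_r3 + 'I_r4)%type.

(** The coordinates of the four Wiener processes form one finite family of scalar Brownian motions,
    as [cvg_in_prob_qcov_ito] expects. *)
Definition noise_process (a : noise) : R -> Omega -> R :=
  match a with
  | inl (inl (inl j)) => fun t w => W1 t w j ord0
  | inl (inl (inr j)) => fun t w => W2 t w j ord0
  | inl (inr j) => fun t w => W3 t w j ord0
  | inr j => fun t w => W4 t w j ord0
  end.

Definition noise_block (a : noise) : 'I_4 :=
  match a with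
  | inl (inl (inl _)) => @Ordinal 4 0 isT
  | inl (inl (inr _)) => @Ordinal 4 1 isT
  | inl (inr _) => @Ordinal 4 2 isT
  | inr _ => @Ordinal 4 3 isT
  end.

Lemma noise_brownian a : brownian_motion P (noise_process a).
Proof.
by case: a => [[[j|j]|j]|j];
  [exact: hW1.1|exact: hW2.1|exact: hW3.1|exact: hW4.1].
Qed.

Lemma sigma_gen_process r (W : R -> Omega -> 'cV[R]_r) j A :
  sigma_gen `[0, +oo[ (fun t w => W t w j ord0) A -> process_sigma W A.
Proof.
apply: sigma_gen_sub => t; rewrite /= in_itv/= andbT => t0.
by exists (t, j).
Qed.

Lemma noise_sigma_block a A : sigma_gen `[0, +oo[ (noise_process a) A ->
  tnth [tuple process_sigma W1; process_sigma W2;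
              process_sigma W3; process_sigma W4] (noise_block a) A.
Proof. by case: a => [[[j|j]|j]|j]; exact: sigma_gen_process. Qed.

(** Across blocks this is the independence of the four Wiener processes; within a block it is the
    independence of coordinates contained in [wiener_process]. *)
Lemma noise_independent a b A B : a != b ->
  sigma_gen `[0, +oo[ (noise_process a) A ->
  sigma_gen `[0, +oo[ (noise_process b) B -> P (A `&` B) = (P A * P B)%E.
Proof.
move=> ab GA GB.
have [ba|nab] := eqVneq (noise_block a) (noise_block b); last first.
  by apply: (mutually_independent_pair hWind nab); exact: noise_sigma_block.
case: a b ab ba GA GB => [[[j|j]|j]|j] [[[k|k]|k]|k]//= ab _ GA GB.
- by apply: (mutually_independent_pair hW1.2 (i := j) (j := k)) => //;
    apply: contra_neq ab => ->.
- by apply: (mutually_independent_pair hW2.2 (i := j) (j := k)) => //;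
    apply: contra_neq ab => ->.
- by apply: (mutually_independent_pair hW3.2 (i := j) (j := k)) => //;
    apply: contra_neq ab => ->.
- by apply: (mutually_independent_pair hW4.2 (i := j) (j := k)) => //;
    apply: contra_neq ab => ->.
Qed.

Lemma sum_noise (f : noise -> R) : \sum_a f a =
  \sum_j f (inl (inl (inl j))) + \sum_j f (inl (inl (inr j)))
  + \sum_j f (inl (inr j)) + \sum_j f (inr j).
Proof. by rewrite !big_sumType. Qed.

Variables (p : nat) (E1 : 'M[R]_(p, k1)) (E2 : 'M[R]_(p, p1))
  (E3 : 'M[R]_(p, p2)) (E4 : 'M[R]_(p, k2)).
Variables (S1 : 'M[R]_(k1, r1)) (S2 : 'M[R]_(p1, r2))
  (S3 : 'M[R]_(p2, r3)) (S4 : 'M[R]_(k2, r4)).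

(** Rows of the concatenated matrix [[E1 S1 | E2 S2 | E3 S3 | E4 S4]], whose Gram matrix is the
    limiting covariance. *)
Definition noise_loading (i : 'I_p) (a : noise) : R :=
  match a with
  | inl (inl (inl j)) => (E1 *m S1) i j
  | inl (inl (inr j)) => (E2 *m S2) i j
  | inl (inr j) => (E3 *m S3) i j
  | inr j => (E4 *m S4) i j
  end.

Lemma sum_noise_loading i j :
  \sum_a noise_loading i a * noise_loading j a =
  (E1 *m (S1 *m S1^T) *m E1^T + E2 *m (S2 *m S2^T) *m E2^T
   + E3 *m (S3 *m S3^T) *m E3^T + E4 *m (S4 *m S4^T) *m E4^T) i j.
Proof.
have H k r (E : 'M[R]_(p, k)) (S : 'M[R]_(k, r)) :
    \sum_l (E *m S) i l * (E *m S) j l = (E *m (S *m S^T) *m E^T) i j.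
  have -> : E *m (S *m S^T) *m E^T = (E *m S) *m (E *m S)^T.
    by rewrite trmx_mul !mulmxA.
  by rewrite mxE; apply: eq_bigr => l _; rewrite !mxE.
by rewrite sum_noise /= !H !mxE.
Qed.

Variables (B1 : 'cV[R]_k1 -> 'cV[R]_k1) (B2 : 'cV[R]_p1 -> 'cV[R]_p1)
  (B3 : 'cV[R]_p2 -> 'cV[R]_p2) (B4 : 'cV[R]_k2 -> 'cV[R]_k2)
  (c1 : 'cV[R]_k1) (c2 : 'cV[R]_p1) (c3 : 'cV[R]_p2) (c4 : 'cV[R]_k2)
  (xi : R -> Omega -> 'cV[R]_k1) (delta : R -> Omega -> 'cV[R]_p1)
  (eps : R -> Omega -> 'cV[R]_p2) (zeta : R -> Omega -> 'cV[R]_k2).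
Hypotheses (hxi : sde_solution P T B1 S1 c1 W1 xi)
  (hdelta : sde_solution P T B2 S2 c2 W2 delta)
  (heps : sde_solution P T B3 S3 c3 W3 eps)
  (hzeta : sde_solution P T B4 S4 c4 W4 zeta).
Hypotheses (cB1 : continuous B1) (cB2 : continuous B2) (cB3 : continuous B3)
  (cB4 : continuous B4).
Variable X : R -> Omega -> 'cV[R]_p.
Hypothesis hX : forall t w, 0 <= t <= T -> X t w =
  E1 *m xi t w + E2 *m delta t w + E3 *m eps t w + E4 *m zeta t w.

Lemma measurable_observed t i : 0 <= t <= T ->
  measurable_fun setT (fun w => X t w i ord0).
Proof.
move=> t0T; have H k (E : 'M[R]_(p, k)) (Y : R -> Omega -> 'cV[R]_k) :
    (forall j, measurable_fun setT (fun w => Y t w j ord0)) ->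
    measurable_fun setT (fun w => (E *m Y t w) i ord0).
  move=> mY; under eq_fun do rewrite mxE.
  by apply: measurable_sum => j; apply: measurable_funM.
under eq_fun do rewrite hX// 3!mxE.
have [mxi _ _] := hxi; have [mde _ _] := hdelta; have [mep _ _] := heps.
have [mze _ _] := hzeta.
have h1 := H _ E1 xi (fun j => mxi t j t0T).
have h2 := H _ E2 delta (fun j => mde t j t0T).
have h3 := H _ E3 eps (fun j => mep t j t0T).
have h4 := H _ E4 zeta (fun j => mze t j t0T).
exact: measurable_funD (measurable_funD (measurable_funD h1 h2) h3) h4.
Qed.

Lemma ae_lipschitz_observed i : ae_lipschitz P T
  (fun t w => X t w i ord0 - \sum_a noise_loading i a * noise_process a t w).
Proof.
have H k r (E : 'M[R]_(p, k)) B (S : 'M[R]_(k, r)) c W Y :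
    sde_solution P T B S c W Y -> continuous B ->
    ae_lipschitz P T (fun t w => (E *m Y t w) i ord0
      - \sum_l (E *m S) i l * W t w l ord0).
  move=> hY cB; have := ae_lipschitz_sum (T := T) (index_enum _) (fun j =>
    ae_lipschitzZ (E i j) (ae_lipschitz_sde T0 j hY cB)).
  apply: ae_lipschitz_ext => // t w _.
  have -> : \sum_l (E *m S) i l * W t w l ord0 = (E *m S *m W t w) i ord0.
    by rewrite mxE.
  rewrite -mulmxA !mxE -sumrB; apply: eq_bigr => j _.
  by rewrite mulrBr !mxE.
have := ae_lipschitzD (ae_lipschitzD (ae_lipschitzD (H _ _ E1 _ _ _ _ _ hxi cB1)
  (H _ _ E2 _ _ _ _ _ hdelta cB2)) (H _ _ E3 _ _ _ _ _ heps cB3))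
  (H _ _ E4 _ _ _ _ _ hzeta cB4).
apply: ae_lipschitz_ext => // t w t0T; rewrite hX// sum_noise /=.
rewrite 3![in RHS]mxE; ring.
Qed.

Lemma cvg_in_prob_quad_cov i j :
  cvg_in_prob P (fun n w => quad_cov T n (fun t => X t w) i j)
  ((E1 *m (S1 *m S1^T) *m E1^T + E2 *m (S2 *m S2^T) *m E2^T
   + E3 *m (S3 *m S3^T) *m E3^T + E4 *m (S4 *m S4^T) *m E4^T) i j).
Proof.
rewrite -sum_noise_loading; under eq_fun do under eq_fun do rewrite quad_covE.
apply: (cvg_in_prob_qcov_ito T0 (W := noise_process) (N := noise_loading)
  (X := fun i t w => X t w i ord0)).
- exact: noise_brownian.
- exact: noise_independent.
- by move=> k t; exact: measurable_observed.
- exact: ae_lipschitz_observed.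
Qed.

Lemma measurable_quad_cov n :
  measurable_mx (fun w => quad_cov T n (fun t => X t w)).
Proof.
move=> i j; under eq_fun do rewrite quad_covE.
apply: measurable_funM => //; apply: measurable_qcov => // t;
exact: measurable_observed.
Qed.

End observed_process.

Lemma regular_drift_continuous (R : realType) k (B : 'cV[R]_k -> 'cV[R]_k) :
  regular_drift B -> continuous B.
Proof. by move=> [_ [_ cB] _]; exact: (cB [::] isT). Qed.

Section sem_loadings.
Variables (R : realType) (p1 p2 k1 k2 : nat).

Lemma Sigma_sem_loadings (m : sem R p1 p2 k1 k2) :
  (Sigma_xixi m)^T = Sigma_xixi m ->
  let E1 := loading_xi (Lambda_x1 m) (Lambda_x2 m) (Gamma_mx m) (Psi_mx m) in
  let E2 := col_mx 1%:M 0 : 'M[R]_(p1 + p2, p1) in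
  let E3 := col_mx 0 1%:M : 'M[R]_(p1 + p2, p2) in
  let E4 := loading_zeta p1 (Lambda_x2 m) (Psi_mx m) in
  Sigma_sem m = E1 *m Sigma_xixi m *m E1^T + E2 *m Sigma_deltadelta m *m E2^T
    + E3 *m Sigma_epseps m *m E3^T + E4 *m Sigma_zetazeta m *m E4^T.
Proof.
move=> /Sigma_semE -> E1 E2 E3 E4.
have -> : block_mx (Sigma_deltadelta m) 0 0 (Sigma_epseps m) =
    E2 *m Sigma_deltadelta m *m E2^T + E3 *m Sigma_epseps m *m E3^T.
  rewrite /E2 /E3 !tr_col_mx !trmx0 !trmx1 !mul_col_mx !mul_mx_row.
  rewrite -![col_mx (row_mx _ _) _]/(block_mx _ _ _ _).
  by rewrite !mul0mx !mulmx0 !mul1mx !mulmx1 add_block_mx !addr0 !add0r.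
rewrite -!addrA; congr (_ + _).
by rewrite [LHS]addrC addrA.
Qed.

(** Solving the structural equation for [eta] removes the feedback and leaves a linear image of the
    four latent vectors, with the loadings that occur in [Sigma_sem_loadings]. *)
Lemma observed_loadings (L1 : 'M[R]_(p1, k1)) (L2 : 'M[R]_(p2, k2))
    (G : 'M[R]_(k2, k1)) (B : 'M[R]_k2) xi delta eta eps zeta :
  1%:M - B \in unitmx -> eta = B *m eta + G *m xi + zeta ->
  col_mx (L1 *m xi + delta) (L2 *m eta + eps) =
  loading_xi L1 L2 G (1%:M - B) *m xi + col_mx 1%:M 0 *m delta
  + col_mx 0 1%:M *m eps + loading_zeta p1 L2 (1%:M - B) *m zeta
  :> 'cV[R]_(p1 + p2).
Proof.
move=> Pu etaE; have -> : eta = invmx (1%:M - B) *m (G *m xi + zeta).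
  rewrite -[LHS](mulKmx Pu); congr (_ *m _).
  by rewrite mulmxBl mul1mx {1}etaE -!addrA addrC -!addrA addNr addr0.
rewrite /loading_xi /loading_zeta !mul_col_mx !mul0mx !mul1mx !add_col_mx.
by rewrite !addr0 !mulmxDr !mulmxA; congr col_mx; rewrite addrAC.
Qed.

End sem_loadings.

Theorem theorem4 (R : realType) (d : measure_display) (Omega : measurableType d)
  (P : probability Omega R)
  (p1 p2 k1 k2 r1 r2 r3 r4 q : nat)
  (hp1 : (0 < p1)%N) (hp2 : (0 < p2)%N) (hk1 : (0 < k1)%N) (hk2 : (0 < k2)%N)
  (hr1 : (0 < r1)%N) (hr2 : (0 < r2)%N) (hr3 : (0 < r3)%N) (hr4 : (0 < r4)%N)
  (hkp1 : (k1 <= p1)%N) (hkp2 : (k2 <= p2)%N)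
  (T : R) (hT : 0 < T)
  (* driving noises *)
  (W1 : R -> Omega -> 'cV[R]_r1) (W2 : R -> Omega -> 'cV[R]_r2)
  (W3 : R -> Omega -> 'cV[R]_r3) (W4 : R -> Omega -> 'cV[R]_r4)
  (hW1 : wiener_process P W1) (hW2 : wiener_process P W2)
  (hW3 : wiener_process P W3) (hW4 : wiener_process P W4)
  (hWind : mutually_independent P
     (tnth [tuple process_sigma W1; process_sigma W2;
                  process_sigma W3; process_sigma W4]))
  (* latent processes *)
  (B1 : 'cV[R]_k1 -> 'cV[R]_k1) (B2 : 'cV[R]_p1 -> 'cV[R]_p1)
  (B3 : 'cV[R]_p2 -> 'cV[R]_p2) (B4 : 'cV[R]_k2 -> 'cV[R]_k2)
  (S1 : 'M[R]_(k1, r1)) (S2 : 'M[R]_(p1, r2))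
  (S3 : 'M[R]_(p2, r3)) (S4 : 'M[R]_(k2, r4))
  (c1 : 'cV[R]_k1) (c2 : 'cV[R]_p1) (c3 : 'cV[R]_p2) (c4 : 'cV[R]_k2)
  (xi : R -> Omega -> 'cV[R]_k1) (delta : R -> Omega -> 'cV[R]_p1)
  (eps : R -> Omega -> 'cV[R]_p2) (zeta : R -> Omega -> 'cV[R]_k2)
  (hxi : sde_solution P T B1 S1 c1 W1 xi)
  (hdelta : sde_solution P T B2 S2 c2 W2 delta)
  (heps : sde_solution P T B3 S3 c3 W3 eps)
  (hzeta : sde_solution P T B4 S4 c4 W4 zeta)
  (hB1 : regular_drift B1) (hB2 : regular_drift B2)
  (hB3 : regular_drift B3) (hB4 : regular_drift B4)
  (hmxi : bounded_moments P T xi) (hmdelta : bounded_moments P T delta)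
  (hmeps : bounded_moments P T eps) (hmzeta : bounded_moments P T zeta)
  (hS2 : pd (S2 *m S2^T)) (hS3 : pd (S3 *m S3^T))
  (* true structural equation model and observed process *)
  (L10 : 'M[R]_(p1, k1)) (L20 : 'M[R]_(p2, k2))
  (G0 : 'M[R]_(k2, k1)) (B0 : 'M[R]_k2)
  (hL10 : \rank L10 = k1) (hB0 : forall i, B0 i i = 0)
  (hPsi0 : 1%:M - B0 \in unitmx)
  (eta : R -> Omega -> 'cV[R]_k2)
  (heta : forall (t : R) (w : Omega), 0 <= t <= T ->
     eta t w = B0 *m eta t w + G0 *m xi t w + zeta t w)
  (X : R -> Omega -> 'cV[R]_(p1 + p2)) (hX : X = observed L10 L20 xi delta eta eps)
  (Sigma0 : 'M[R]_(p1 + p2))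
  (hSigma0 : Sigma0 = Sigma_sem (Sem L10 L20 G0 (1%:M - B0)
     (S1 *m S1^T) (S2 *m S2^T) (S3 *m S3^T) (S4 *m S4^T)))
  (* parametric model *)
  (Theta : set 'rV[R]_q)
  (hconv : convex_set (Theta : set (convex_lmodType 'rV[R]_q)))
  (hcomp : compact Theta)
  (M : 'rV[R]_q -> sem R p1 p2 k1 k2) (hM : parametric_sem Theta M)
  (* contrast and estimator *)
  (Fn : nat -> Omega -> 'rV[R]_q -> R)
  (hFn : Fn = fun n w theta =>
     quasi_contrast (quad_cov T n (fun t => X t w)) (Sigma_sem (M theta)))
  (thetahat : nat -> Omega -> 'rV[R]_q)
  (hthetahat : min_contrast_estimator Theta Fn thetahat)
  (* the alternative, and the test *)
  (hH1 : forall theta, Theta theta -> Sigma0 <> Sigma_sem (M theta))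
  (hU : exists! thetabar, is_minimizer Theta
     (fun theta => F_contrast Sigma0 (Sigma_sem (M theta))) thetabar)
  (hq : (q < vech_dim (p1 + p2))%N)
  (alpha : R) (halpha : 0 < alpha < 1)
  (c : R) (hc : is_chi2_upper_point (vech_dim (p1 + p2) - q) alpha c) :
  P [set w | c < n%:R * Fn n w (thetahat n w)] @[n --> \oo] --> 1%E.
Proof.
set Psi := 1%:M - B0 in hPsi0.
pose E1 := loading_xi L10 L20 G0 Psi.
pose E2 : 'M[R]_(p1 + p2, p1) := col_mx 1%:M 0.
pose E3 : 'M[R]_(p1 + p2, p2) := col_mx 0 1%:M.
pose E4 := loading_zeta p1 L20 Psi.
have XE t w : 0 <= t <= T -> X t w =
    E1 *m xi t w + E2 *m delta t w + E3 *m eps t w + E4 *m zeta t w.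
  by move=> t0T; rewrite hX; apply: observed_loadings => //; exact: heta.
have S0E : Sigma0 = E1 *m (S1 *m S1^T) *m E1^T + E2 *m (S2 *m S2^T) *m E2^T
    + E3 *m (S3 *m S3^T) *m E3^T + E4 *m (S4 *m S4^T) *m E4^T.
  by rewrite hSigma0 Sigma_sem_loadings//= trmx_mul trmxK.
have pS0 : pd Sigma0.
  by rewrite hSigma0; apply: pd_Sigma_sem => //=; exact: psd_gram.
have cB1 := regular_drift_continuous hB1.
have cB2 := regular_drift_continuous hB2.
have cB3 := regular_drift_continuous hB3.
have cB4 := regular_drift_continuous hB4.
have QS0 i j : cvg_in_prob P (fun n w => quad_cov T n (fun t => X t w) i j)
    (Sigma0 i j).
  rewrite S0E.
  exact: (cvg_in_prob_quad_cov hT hW1 hW2 hW3 hW4 hWind hxi hdelta heps hzeta).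
have mQ n : measurable_mx (fun w => quad_cov T n (fun t => X t w)).
  exact: (measurable_quad_cov hT hxi hdelta heps hzeta XE).
have [e [c0 [e0 c00 HF]]] := F_contrast_lower_bound hM hcomp pS0 hH1.
have mF n : (0 < n)%N -> measurable_fun setT (fun w => Fn n w (thetahat n w)).
  move=> n0; have [mth Tth _] := hthetahat n n0.
  rewrite hFn; apply: measurable_quasi_contrast => //.
    (* The limit slot of the measurability relation is a placeholder that must lie in [Theta]; the
       minimizer fills it. *)
    have [thetabar [[Ttb _] _]] := hU.
    exact: (stable_Sigma_model hM (stable_measurable R Omega)
      (fun w _ => Tth w) Ttb).
  by move=> w; exact: (pd_Sigma_model hM).
apply: cvg_probability1 => eta0 eta00.
have := cvg_in_prob_family
  (Z := fun ij n w => quad_cov T n (fun t => X t w) ij.1 ij.2)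
  (fun ij => QS0 ij.1 ij.2) e0 eta00.
move=> QE; near=> n.
have n0 : (0 < n)%N by near: n; exact: nbhs_infty_gt.
split.
  rewrite (_ : [set w | _] =
      (fun w => n%:R * Fn n w (thetahat n w)) @^-1` `]c, +oo[).
    rewrite -[X in measurable X]setTI.
    have : measurable_fun setT (fun w => n%:R * Fn n w (thetahat n w)).
      by apply: measurable_funM => //; exact: mF.
    by apply=> //; exact: measurable_itv.
  by apply/seteqP; split=> w /=; rewrite in_itv/= andbT.
have [E [mE PE HE]] : exists E, [/\ measurable E, (P (~` E) <= eta0%:E)%E &
    forall w ij, E w -> `|quad_cov T n (fun t => X t w) ij.1 ij.2
      - Sigma0 ij.1 ij.2| <= e] by near: n.
exists E; split=> // w Ew /=; have [_ Tth _] := hthetahat n n0.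
have [Qu c0F] := HF _ _ (Tth w) (fun i j => HE w (i, j) Ew).
(* [Qu] selects the logarithmic branch of the contrast, and [n > c / c0] is enough for the
   comparison with [c]. *)
rewrite hFn /quasi_contrast Qu; apply: (@lt_trans _ _ (n%:R * c0)).
  rewrite -ltr_pdivrMr//; near: n; exact: nbhs_infty_gtr.
by rewrite ltr_pM2l// ltr0n.
Unshelve. all: by end_near. Qed.
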